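(* For any $1\le m\le M$, the fully discrete discontinuous Galerkin time stepping solution $U$ (with $U|_{I_i}\in\mathbb{P}^{r_i}(I_i;\mathbb{X}_i)$ for $1\le i\le M$), determined iteratively by $U_0^-:=\pi_0u_0$ and $$\int_{I_i}(U',V)_{\mathbb H}\,dt+(U_{i-1}^+-U_{i-1}^-,V_{i-1}^+)_{\mathbb H}+\int_{I_i}\langle \mathsf{A}U,V\rangle_{\mathbb{X}^\star\times\mathbb{X}}\,dt=\int_{I_i}(f,V)_{\mathbb H}\,dt\qquad\forall V\in\mathbb{P}^{r_i}(I_i;\mathbb{X}_i),\quad 1\le i\le M,$$ fulfills the stability estimate $$\|U\|_{L^\infty((0,t_m);\mathbb{H})}\le\|\pi_0u_0\|_{\mathbb{H}}+\gamma_m\,t_m^{1/2}\,\|f\|_{L^2((0,t_m);\mathbb{H})},$$ where $\gamma_m:=\max_{1\le i\le m}C_i$.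
   Context: Setting. $\mathbb{H}$ and $\mathbb{X}$ are real Hilbert spaces with inner products $(\cdot,\cdot)_{\mathbb H}$, $(\cdot,\cdot)_{\mathbb X}$ and induced norms; $\mathbb{X}$ is densely and continuously embedded in $\mathbb{H}$, giving the Gelfand triple $\mathbb{X}\hookrightarrow\mathbb{H}\cong\mathbb{H}^\star\hookrightarrow\mathbb{X}^\star$, with duality pairing $\langle\cdot,\cdot\rangle_{\mathbb{X}^\star\times\mathbb{X}}$. $\mathsf{A}:\mathbb{X}\to\mathbb{X}^\star$ is linear, self-adjoint (i.e. $\langle\mathsf{A}v,w\rangle=\langle\mathsf{A}w,v\rangle$), time-independent, coercive ($\langle\mathsf{A}v,v\rangle\ge\alpha\|v\|_{\mathbb X}^2$ for some $\alpha>0$) and bounded ($|\langle\mathsf{A}v,w\rangle|\le\beta\|v\|_{\mathbb X}\|w\|_{\mathbb X}$ for some $\beta>0$). $T>0$, $f\in L^2((0,T);\mathbb{H})$ and $u_0\in\mathbb{H}$. Discretization. $0=t_0<t_1<\dots<t_M=T$, $I_i=(t_{i-1},t_i]$, $k_i=t_i-t_{i-1}$, $r_i\ge0$ are integers ($1\le i\le M$). $\mathbb{X}_i\subset\mathbb{X}$, $0\le i\le M$, are finite-dimensional subspaces, $n_i=\dim\mathbb{X}_i$. $\mathbb{P}^{r}(J;\mathbb{V})$ is the space of polynomials in $t\in J$ of degree at most $r$ with coefficients in $\mathbb{V}$; $\mathbb{P}^r(J)=\mathbb{P}^r(J;\mathbb{R})$. $v_i^{\pm}$ denote the one-sided limits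 of $v$ at $t_i$ from the right ($+$) and left ($-$). $\pi_i:\mathbb{H}\to\mathbb{X}_i$ is the $\mathbb{H}$-orthogonal projection. The discrete problem is uniquely solvable. Constants. For $1\le i\le M$, let $\mathsf{A}_i:\mathbb{X}_i\to\mathbb{X}_i$ be given by $(\mathsf{A}_iu,v)_{\mathbb H}=\langle\mathsf{A}u,v\rangle_{\mathbb{X}^\star\times\mathbb{X}}$ for all $v\in\mathbb{X}_i$, and let $\lambda_1^{(i)},\dots,\lambda_{n_i}^{(i)}>0$ be its eigenvalues (with respect to an $(\cdot,\cdot)_{\mathbb H}$-orthonormal basis of eigenvectors). Then $$C_i:=\max_{1\le j\le n_i}C(\lambda_j^{(i)},r_i,i),\qquad C(\lambda,r_i,i):=\Upsilon(r_i,k_i\lambda)\left\|\frac{e_{\lambda,i}}{e_{\lambda,i}(t_{i-1})}\right\|_{L^\infty(I_i)}+1,$$ where $\Upsilon(r,\varrho):=\left(\frac{3}{2(2r+1)+\varrho}\right)^{1/2}$ and $e_{\lambda,i}(t):=e^{-\lambda(t-t_{i-1})}-\psi_\lambda^{r_i}(t)$. Here $\psi_\lambda^{r_i}\in\mathbb{P}^{r_i}(I_i)$ is the scalar dG fundamental solution: the unique polynomial with $\int_{I_i}\big((\psi_\lambda^{r_i})'+\lambda\psi_\lambda^{r_i}\big)V\,dt+\psi_\lambda^{r_i}(t_{i-1})V(t_{i-1})=V(t_{i-1})$ for all $V\in\mathbb{P}^{r_i}(I_i)$ (polynomial values at $t_{i-1}$ are limits from the right). For $\lambda>0$ one has $e_{\lambda,i}(t_{i-1})=1-\psi_\lambda^{r_i}(t_{i-1})>0$,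 so the quotient is well defined. *)

(* Defs.v *)
From HB Require Import structures.
From mathcomp Require Import all_boot all_order all_algebra.
From mathcomp Require Import all_classical all_reals all_analysis.

Set Implicit Arguments.
Unset Strict Implicit.
Unset Printing Implicit Defensive.

Import Order.TTheory GRing.Theory Num.Theory.
Import numFieldNormedType.Exports.

Local Open Scope classical_set_scope.
Local Open Scope ring_scope.

(* A real Hilbert space is a complete normed module together with an inner
   product that induces its norm. *)
Definition induces_norm (R : realType) (V : normedModType R)
    (dot : {dot V for idfun}) : Prop :=
  forall x : V, `|x| = Num.sqrt (dot x x).

Definition dual (R : realType) (V : normedModType R) : set (V -> R^o) :=
  [set phi | linear phi /\ continuous phi].

Definition findim_subspace (R : realType) (V : lmodType R) (W : set V) : Prop :=
  exists (n : nat) (b : 'I_n -> V),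
    W = [set x | exists c : 'I_n -> R, x = \sum_(j < n) c j *: b j].

Section Lebesgue.
Context {R : realType} {V : completeNormedModType R}.
Local Notation mu := (@lebesgue_measure R).

(* [g \_ D] vanishes outside D, so the two norms below are those of Lp(D; V). *)
Definition Linf_norm (D : set R) (g : R -> V) : \bar R :=
  'N[mu]_+oo[EFin \o ((fun s => `|g s|%R) \_ D)]%E.

Definition L2_norm (D : set R) (g : R -> V) : \bar R :=
  'N[mu]_2%:E[EFin \o ((fun s => `|g s|%R) \_ D)]%E.

(* Bochner measurability. *)
Definition simple_function (g : R -> V) : Prop :=
  finite_set (range g) /\ forall y, measurable (g @^-1` [set y]).

Definition strongly_measurable (D : set R) (g : R -> V) : Prop :=
  exists s : nat -> R -> V,
    (forall n, simple_function (s n)) /\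
    {ae mu, forall x, D x -> (fun n => s n x) @ \oo --> g x}.

Definition in_L2 (D : set R) (g : R -> V) : Prop :=
  strongly_measurable D g /\ (L2_norm D g < +oo)%E.

End Lebesgue.

Section Polynomials.
Context {R : realType} {V : lmodType R}.

(* P^r(J; W) *)
Definition poly_on (J : set R) (r : nat) (W : set V) (v : R -> V) : Prop :=
  exists c : 'I_r.+1 -> V, (forall k, W (c k)) /\
    forall s, J s -> v s = \sum_(k < r.+1) s ^+ k *: c k.

End Polynomials.

Section ScalarConstants.
Context {R : realType}.
Local Notation mu := (@lebesgue_measure R).

Definition dG_psi (lam : R) (r : nat) (a b : R) : {poly R} :=
  xget 0 [set p : {poly R} | (size p <= r.+1)%N /\
    forall q : {poly R}, (size q <= r.+1)%N ->
      \int[mu]_(s in `]a, b]) ((p^`().[s] + lam * p.[s]) * q.[s])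
        + p.[a] * q.[a] = q.[a]].

Definition dG_err (lam : R) (r : nat) (a b : R) (s : R) : R :=
  expR (- lam * (s - a)) - (dG_psi lam r a b).[s].

Definition Upsilon (r : nat) (rho : R) : R :=
  Num.sqrt (3 / (2 * (2 * r%:R + 1) + rho)).

Definition C_scalar (lam : R) (r : nat) (a b : R) : R :=
  Upsilon r ((b - a) * lam) *
    fine (Linf_norm (V := R^o) `]a, b]
            (fun s => dG_err lam r a b s / dG_err lam r a b a)) + 1.

End ScalarConstants.

Section GelfandTriple.
Context {R : realType} {H X : completeNormedModType R}.
Variables (dotH : {dot H for idfun}) (iota : {linear X -> H}).
Variable A : {linear X -> (X -> R^o)}.
Local Notation mu := (@lebesgue_measure R).

(* The H-orthogonal projection onto a finite-dimensional W, as an element of X. *)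
Definition orth_proj (W : set X) (h : H) : X :=
  xget 0 [set w | W w /\ forall v, W v -> dotH (iota w) (iota v) = dotH h (iota v)].

Definition discrete_op (W : set X) (u : X) : X :=
  xget 0 [set w | W w /\ forall v, W v -> dotH (iota w) (iota v) = A u v].

Definition discrete_eigenvalue (W : set X) (lam : R) : Prop :=
  exists u, [/\ W u, u <> 0 & discrete_op W u = lam *: u].

(* The set of eigenvalues is finite, so that this supremum is a maximum; it
   is 0 if W = {0}, where there is no eigenvalue. *)
Definition C_max (W : set X) (r : nat) (a b : R) : R :=
  sup [set C_scalar lam r a b | lam in discrete_eigenvalue W].

(* The values of the two-sided derivative [derive1 U] at the nodes are irrelevant
   for the integral. *)
Definition dG_step (W : set X) (r : nat) (a b : R) (f : R -> H)
    (U : R -> X) (Uminus : X) : Prop :=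
  poly_on `]a, b] r W U /\
  forall V : R -> X, poly_on `]a, b] r W V ->
    \int[mu]_(s in `]a, b]) dotH (iota (derive1 U s)) (iota (V s))
    + dotH (iota (lim (U @ a^'+) - Uminus)) (iota (lim (V @ a^'+)))
    + \int[mu]_(s in `]a, b]) A (U s) (V s)
    = \int[mu]_(s in `]a, b]) dotH (f s) (iota (V s)).

(* U_i^- *)
Definition left_value (t : nat -> R) (Xs : nat -> set X) (u0 : H) (U : R -> X)
    (i : nat) : X :=
  if i is 0%N then orth_proj (Xs 0%N) u0 else lim (U @ (t i)^'-).

Definition dG_solution (M : nat) (t : nat -> R) (r : nat -> nat)
    (Xs : nat -> set X) (f : R -> H) (u0 : H) (U : R -> X) : Prop :=
  forall i, (1 <= i <= M)%N ->
    dG_step (Xs i) (r i) (t i.-1) (t i) f U (left_value t Xs u0 U i.-1).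

Definition dG_gamma (t : nat -> R) (r : nat -> nat) (Xs : nat -> set X)
    (m : nat) : R :=
  \big[Num.max/0]_(1 <= i < m.+1) C_max (Xs i) (r i) (t i.-1) (t i).

End GelfandTriple.

(* Main.v *)
Require Import Defs.
From HB Require Import structures.
From mathcomp Require Import all_boot all_order all_algebra.
From mathcomp Require Import all_classical all_reals all_analysis.
From mathcomp Require Import ess_sup_inf measurable_realfun.
From mathcomp Require Import spectral.
From mathcomp.real_closed Require Import complex.
From mathcomp Require Import ring lra zify.

Import Order.TTheory GRing.Theory Num.Theory.
Import numFieldNormedType.Exports.

Local Open Scope classical_set_scope.
Local Open Scope ring_scope.

(** On one time interval ]a, b] of length k, the scheme decouples along
    eigenvectors phi_j of the discrete operator: the coordinate
    p_j = (U, phi_j) solves a scalar scheme with eigenvalue lam_j and initial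
    value g_j = (U^-, phi_j). Let chi be the lifting polynomial, which
    represents q |-> q(a) on P^r in the L2 product of the interval, and let
    P_j = p_j' + lam_j p_j + (p_j(a) - g_j) chi be the residual: the scheme says
    that P_j is the L2 projection of (f, phi_j) on P^r.

    The core is the scalar estimate [dG_scalar_bound],
        |p| <= |g| + C(lam) sqrt(k) ||P||_2,
    which holds for every p in P^r. Split p = g psi + v with psi the
    fundamental solution.
    - |psi| <= 1: psi is a multiple of S = sum_i (-1)^i chi^(i) / lam^(i+1),
      which solves S' + lam S = chi. The polynomial chi and all its derivatives
      are Jacobi polynomials whose modulus is largest at a, where the signs of
      chi^(i) alternate ([jacobi_exists]); so |psi| <= psi(a) < 1.
    - With eps = e / e(a) one has eps' + lam eps = - chi and eps(a) = 1, so
      v = v(a) eps + z with z' + lam z = P and z(a) = 0. Here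
      |z| <= sqrt(k) ||P||_2 ([damped_bound]) accounts for the summand 1 of C,
      and |v(a)| <= Upsilon sqrt(k) ||P||_2 ([trace_bound]) for the other one.

    Back in the space W, testing the scheme with V = sum_j P_j phi_j gives
    sum_j ||P_j||^2 = int (f, V) <= ||f|| (sum_j ||P_j||^2)^(1/2), whence
    sum_j ||P_j||^2 <= ||f||^2 on the interval, and Minkowski's inequality over j
    yields the bound for one step, [dG_step_bound]. The steps add up by
    sqrt(t E) + sqrt(k N) <= sqrt((t + k) (E + N)), where E and N are the
    squared norms of f on ]0, t[ and on the next interval.

    Of an orthonormal eigenbasis only Parseval's identity is used. A family with
    that property is read off from a unitary diagonalization of the stiffness
    matrix over the complex numbers: the real and imaginary parts of its
    eigenvectors are real eigenvectors or zero. Integrals of f are estimated on the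
    suprema of simple functions that define them. *)

Set Implicit Arguments.
Unset Strict Implicit.
Unset Printing Implicit Defensive.

(** * Integrals of polynomials over an interval *)

Section PolynomialIntegrals.
Context {R : realType}.
Implicit Types p q : {poly R}.

Lemma poly_nondecreasing p (a b : R) : (forall x, a < x < b -> 0 <= p^`().[x]) ->
  forall x y, a <= x -> x <= y -> y <= b -> p.[x] <= p.[y].
Proof.
move=> p'_ge0 x y ax xy yb.
have dp (z : R) : is_derive z (1 : R) (horner p) p^`().[z] by exact: is_derive_poly.
apply: (@ger0_derive1_ndecr _ (horner p) a b) => //.
- by move=> z; rewrite in_itv /= derive1E derive_val; exact: p'_ge0.
- exact/continuous_subspaceT/continuous_horner.
Qed.

(** The constant coefficient is [p`_0 / 0], that is 0. *)
Definition prim p : {poly R} := \poly_(i < (size p).+1) (p`_i.-1 / i%:R).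

Lemma coef_prim p i : (prim p)`_i = p`_i.-1 / i%:R.
Proof.
rewrite coef_poly; case: ltnP => // ltpi; case: i ltpi => // i ltpi.
by rewrite /= nth_default ?mul0r.
Qed.

Lemma prim_is_linear : linear prim.
Proof.
by move=> c p q; apply/polyP => i; rewrite !(coefD, coefZ, coef_prim) mulrDl mulrA.
Qed.

Lemma deriv_prim p : (prim p)^`() = p.
Proof.
by apply/polyP => i; rewrite coef_deriv coef_prim -[LHS]mulr_natr divfK ?pnatr_eq0.
Qed.

Lemma prim_deriv p : prim p^`() = p - (p`_0)%:P.
Proof.
apply/polyP => -[|i]; rewrite coef_prim coefB coefC ?invr0 ?mulr0 ?subrr//=.
by rewrite coef_deriv subr0 -[X in X / _]mulr_natr mulfK ?pnatr_eq0.
Qed.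

(** An algebraic form of the integral of [p] over [a, b]: linearity and
    integration by parts become polynomial identities, and the Lebesgue integral
    enters only through [integral_poly]. *)
Definition pint (a b : R) p : R := (prim p).[b] - (prim p).[a].

Lemma pint_is_scalar a b : scalar (pint a b).
Proof.
move=> c p q; rewrite /pint prim_is_linear !hornerD !hornerZ [RHS]/=; ring.
Qed.

HB.instance Definition _ a b := GRing.isLinear.Build _ _ _ _ (pint a b)
  (pint_is_scalar a b).

Lemma pint_deriv a b p : pint a b p^`() = p.[b] - p.[a].
Proof. by rewrite /pint prim_deriv !hornerE; ring. Qed.

Lemma pintZ a b c p : pint a b (c *: p) = c * pint a b p.
Proof. by rewrite linearZ. Qed.

Variables (a b : R).
Hypothesis ltab : a < b.
Let leab : a <= b. Proof. exact: ltW. Qed.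

Lemma pint_ge0 p : (forall x, a < x < b -> 0 <= p.[x]) -> 0 <= pint a b p.
Proof.
move=> p_ge0; rewrite subr_ge0; apply: (@poly_nondecreasing _ a b) => // x.
by rewrite deriv_prim; exact: p_ge0.
Qed.

Lemma pint_sqr_ge0 p : 0 <= pint a b (p ^+ 2).
Proof. by apply: pint_ge0 => x _; rewrite horner_exp sqr_ge0. Qed.

Lemma integral_poly p :
  (\int[lebesgue_measure]_(x in `]a, b[) (p.[x])%:E = (pint a b p)%:E)%E.
Proof.
have cp : {within `[a, b], continuous (horner p)}.
  exact/continuous_subspaceT/continuous_horner.
have mp D : measurable_fun D (horner p) by exact: measurable_poly.
rewrite integral_itv_bndo_bndc; last exact/measurable_EFinP.
rewrite integral_itv_obnd_cbnd; last exact/measurable_EFinP.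
rewrite (@continuous_FTC2 _ _ (horner (prim p)))//.
  split.
  - by move=> x _; exact: derivable_horner.
  - by apply: cvg_at_right_filter; exact: continuous_horner.
  - by apply: cvg_at_left_filter; exact: continuous_horner.
by move=> x _; rewrite -derivE deriv_prim.
Qed.

(** The value of [g] at [b] does not matter: the derivative of the discrete
    solution, as a two-sided limit, has no meaning at the right node. *)
Lemma Rintegral_eq_pint (g : R -> R) p : (forall s, a < s < b -> g s = p.[s]) ->
  (\int[lebesgue_measure]_(s in `]a, b]) g s)%R = pint a b p.
Proof.
move=> gE.
have gE' : {in `]a, b[%classic, EFin \o horner p =1 EFin \o g}.
  by move=> s /set_mem; rewrite /= in_itv /= => sab; rewrite gE.
have ip_cc : lebesgue_measure.-integrable `[a, b] (EFin \o horner p).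
  apply: continuous_compact_integrable; first exact: segment_compact.
  exact/continuous_subspaceT/continuous_horner.
have ip : lebesgue_measure.-integrable `]a, b[ (EFin \o horner p).
  by apply: integrableS ip_cc => //; exact: subset_itv_oo_cc.
have ig : lebesgue_measure.-integrable `]a, b[ (EFin \o g).
  by apply: eq_integrable ip; [exact: measurable_itv|exact: gE'].
rewrite -Rintegral_itv_bndo_bndc// /Rintegral -[RHS]/(fine (pint a b p)%:E).
by rewrite -integral_poly; congr fine; apply: eq_integral => s /gE'.
Qed.

End PolynomialIntegrals.

(** * Jacobi polynomials and their maximum modulus *)

Section Jacobi.
Context {R : realType}.
Variables (a b : R).
Hypothesis ltab : a < b.
Let k := b - a.
Let w : {poly R} := ('X - a%:P) * (b%:P - 'X).
Let k_gt0 : 0 < k. Proof. by rewrite subr_gt0. Qed.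

(** The equation of the Jacobi polynomial of degree [n], moved to [a, b]; for
    the weight (x - a)^beta (b - x)^alpha one has [A = beta + 1] and
    [B = alpha + beta + 2]. Derivatives stay in the family: the derivative of a
    solution for (n + 1, A, B) solves the equation for (n, A + 1, B + 2). *)
Definition jacobi_ode (n : nat) (A B : R) (y : {poly R}) : Prop :=
  w * y^`()^`() + ((A * k)%:P - B%:P * ('X - a%:P)) * y^`()
    + (n%:R * (n%:R - 1 + B))%:P * y = 0.

(** Inverts that passage. If [y' = - (mu / (A k)) z], with [mu] the coefficient
    of [y] in the equation of [y], then this equation gives [y] in terms of [z]
    and [z']. The factor keeps the value at [a] unchanged. *)
Definition jacobi_next (A B : R) (z : {poly R}) : {poly R} :=
  ((A * k)^-1)%:P * (w * z^`() + ((A * k)%:P - B%:P * ('X - a%:P)) * z).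

Lemma deriv_w : w^`() = k%:P - 2%:P * ('X - a%:P).
Proof. by rewrite /w /k !poly.derivE; ring. Qed.

Lemma deriv_jacobi_next n A B z : 0 < A ->
  jacobi_ode n (A + 1) (B + 2) z ->
  (jacobi_next A B z)^`() = - (n.+1%:R * (n%:R + B) / (A * k))%:P * z.
Proof.
move=> A_gt0 ode; rewrite /jacobi_next derivM derivC mul0r add0r derivD derivM.
rewrite deriv_w derivM derivB derivC derivM derivC derivB derivX derivC.
have := ode; rewrite /jacobi_ode => /eqP; rewrite -addrA addr_eq0 => /eqP.
move=> ->; rewrite -natr1; ring.
Qed.

Lemma jacobi_ode_next n A B z : 0 < A ->
  jacobi_ode n (A + 1) (B + 2) z ->
  jacobi_ode n.+1 A B (jacobi_next A B z).
Proof.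
move=> A_gt0 ode; rewrite /jacobi_ode (deriv_jacobi_next A_gt0 ode) /jacobi_next.
rewrite derivM derivN derivC -natr1.
have -> : n%:R + 1 - 1 + B = n%:R + B by ring.
ring.
Qed.

Lemma jacobi_next_a A B z : 0 < A -> (jacobi_next A B z).[a] = z.[a].
Proof.
by move=> A_gt0; rewrite !hornerE; field; rewrite !gt_eqF.
Qed.

Lemma jacobi_next_b A B z : 0 < A ->
  (jacobi_next A B z).[b] = (A - B) / A * z.[b].
Proof.
move=> A_gt0; rewrite !hornerE -/k; field; rewrite !gt_eqF//.
Qed.

(** Sonin's argument: [F = y^2 + w y'^2 / mu] dominates [y^2], agrees with it at
    [a] and [b], and has derivative [y'^2 / mu] times a nondecreasing affine
    function. So [F] decreases and then increases, and is largest at an end. *)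
Lemma sonin n A B y : 1 / 2 <= A -> 1 <= B -> (0 < n)%N -> jacobi_ode n A B y ->
  forall x, a <= x <= b -> `|y.[x]| <= Num.max `|y.[a]| `|y.[b]|.
Proof.
move=> A_ge B_ge n_gt0 ode x /andP[ax xb].
have n_ge1 : 1 <= n%:R :> R by rewrite ler1n.
set mu : R := n%:R * (n%:R - 1 + B).
have mu_gt0 : 0 < mu by apply: mulr_gt0; lra.
pose F : {poly R} := y ^+ 2 + (mu^-1)%:P * (w * y^`() ^+ 2).
have F' : F^`() = (mu^-1)%:P * y^`() ^+ 2 *
    (((1 - 2 * A) * k)%:P + (2 * B - 2)%:P * ('X - a%:P)).
  have wy'' : w * y^`()^`() =
      - (((A * k)%:P - B%:P * ('X - a%:P)) * y^`() + mu%:P * y).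
    by apply/eqP; rewrite -addr_eq0 addrA; apply/eqP.
  have mu1 : (mu^-1)%:P * mu%:P = 1 :> {poly R}.
    by rewrite -polyCM mulVf ?gt_eqF.
  have -> : F^`() = 2%:P * y * y^`() + (mu^-1)%:P *
      (w^`() * y^`() ^+ 2 + 2%:P * y^`() * (w * y^`()^`())).
    by rewrite /F; move: (w) => w0; rewrite !expr2 !derivD !derivM !derivC; ring.
  rewrite wy'' deriv_w.
  have -> : 2%:P * y * y^`() = (mu^-1)%:P * mu%:P * (2%:P * y * y^`())
    by rewrite mu1 mul1r.
  ring.
have y2F z : a <= z <= b -> y.[z] ^+ 2 <= F.[z].
  move=> /andP[az zb].
  have -> : F.[z] = y.[z] ^+ 2 + mu^-1 * ((z - a) * (b - z) * y^`().[z] ^+ 2).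
    by rewrite !hornerE /=; ring.
  rewrite lerDl; apply: mulr_ge0; first by rewrite invr_ge0 ltW.
  by apply: mulr_ge0; [apply: mulr_ge0; rewrite subr_ge0|exact: sqr_ge0].
have Fa : F.[a] = y.[a] ^+ 2 by rewrite !hornerE /=; ring.
have Fb : F.[b] = y.[b] ^+ 2 by rewrite !hornerE /=; ring.
have F'E x0 : F^`().[x0] = mu^-1 * y^`().[x0] ^+ 2 *
    ((1 - 2 * A) * k + (2 * B - 2) * (x0 - a)).
  by rewrite F' !hornerE.
have F'c_ge0 x0 : 0 <= mu^-1 * y^`().[x0] ^+ 2.
  by apply: mulr_ge0; [rewrite invr_ge0 ltW|exact: sqr_ge0].
have yx2 : y.[x] ^+ 2 <= F.[x] by apply: y2F; rewrite ax.
rewrite le_max.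
(* The affine factor of F' at x: if it is not positive, F decreases on [a, x];
   otherwise F increases on [x, b]. *)
have [s_le0|s_gt0] := leP ((1 - 2 * A) * k + (2 * B - 2) * (x - a)) 0.
  apply/orP; left.
  suff Fx : F.[x] <= F.[a].
    by rewrite -ler_sqr ?nnegrE// !real_normK ?num_real// -Fa (le_trans yx2).
  rewrite -lerN2 -!hornerN; apply: (@poly_nondecreasing _ _ a x) => // z /andP[az zx].
  rewrite derivN hornerN oppr_ge0 F'E mulr_ge0_le0//.
  apply: le_trans s_le0; rewrite lerD2l ler_wpM2l//; lra.
apply/orP; right.
suff Fx : F.[x] <= F.[b].
  by rewrite -ler_sqr ?nnegrE// !real_normK ?num_real// -Fb (le_trans yx2).
apply: (@poly_nondecreasing _ _ x b) => // z /andP[xz zb].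
rewrite F'E mulr_ge0//.
apply: le_trans (ltW s_gt0) _; rewrite lerD2l ler_wpM2l//; lra.
Qed.

Lemma size_jacobi_next n A B (z : {poly R}) : (size z <= n.+1)%N ->
  (size (jacobi_next A B z) <= n.+2)%N.
Proof.
move=> sz.
have s1 (c d : R) : (size (c%:P * ('X - a%:P) + d%:P)%R <= 2)%N.
  apply: leq_trans (size_polyD _ _) _; rewrite geq_max.
  rewrite (leq_trans (size_polyMleq _ _)) ?size_XsubC ?addn2 /=; last first.
    by rewrite ltnS size_polyC_leq1.
  by rewrite (leq_trans (size_polyC_leq1 _)).
have sM (p q : {poly R}) m : (size p <= 2)%N ->
    (size q <= m)%N -> (size (p * q)%R <= m.+1)%N.
  move=> sp sq; have := size_polyMleq p q.
  by move: (size p) (size q) (size (p * q)%R) sp sq; lia.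
rewrite /jacobi_next mul_polyC (leq_trans (size_scale_leq _ _))//.
rewrite (leq_trans (size_polyD _ _))// geq_max; apply/andP; split.
  rewrite /w -mulrA; apply: (sM) => //; first by rewrite size_XsubC.
  have -> : b%:P - 'X = (-1)%:P * ('X - a%:P) + (b - a)%:P :> {poly R} by ring.
  case: (posnP n) => [n0|n_gt0].
    have -> : z^`() = 0.
      by rewrite [z](size1_polyC) ?derivC// -n0.
    by rewrite mulr0 size_poly0.
  have [->|zN0] := eqVneq z 0; first by rewrite deriv0 mulr0 size_poly0.
  apply: sM; first exact: s1.
  have := lt_size_deriv zN0; lia.
apply: sM => //.
have -> : (A * k)%:P - B%:P * ('X - a%:P) =
    (- B)%:P * ('X - a%:P) + (A * k)%:P :> {poly R}.
  by ring.
exact: s1.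
Qed.

(** The induction runs from [z], proportional to the derivative, to [y]. By
    [sonin] only the ends matter for the maximum of [|y|], and the equation at [b]
    gives [y(b) = (A - B) / A * z(b)], which has modulus at most 1 as
    [A <= B <= 2 A]. Since [y' = - c z] with [c >= 0], a solution [S1] for [z]
    gives the solution [S = (y + c S1) / lam] for [y]; both terms of [S] are
    largest in modulus, and nonnegative, at [a]. *)
Lemma jacobi_exists n A B : 1 / 2 <= A -> 1 <= B -> A <= B -> B <= 2 * A ->
  exists y : {poly R}, [/\ (size y <= n.+1)%N, jacobi_ode n A B y, y.[a] = 1,
    forall x, a <= x <= b -> `|y.[x]| <= 1 &
    forall lam, 0 < lam -> exists S : {poly R}, [/\ (size S <= n.+1)%N,
      S^`() + lam%:P * S = y & forall x, a <= x <= b -> `|S.[x]| <= S.[a]]].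
Proof.
elim: n A B => [|n IHn] A B A_ge B_ge AB BA.
  exists 1; split.
  - by rewrite size_poly1.
  - by rewrite /jacobi_ode !poly.derivE mul0r polyC0; ring.
  - by rewrite hornerC.
  - by move=> x _; rewrite hornerC normr1.
  - move=> lam lam_gt0; exists (lam^-1)%:P; split.
    + by rewrite size_polyC_leq1.
    + by rewrite derivC add0r -polyCM mulfV ?gt_eqF.
    + by move=> x _; rewrite !hornerC ger0_norm// invr_ge0 ltW.
have [z [sz ode_z za z_le1 Sz]] : exists y : {poly R}, [/\ (size y <= n.+1)%N,
    jacobi_ode n (A + 1) (B + 2) y, y.[a] = 1,
    forall x, a <= x <= b -> `|y.[x]| <= 1 &
    forall lam, 0 < lam -> exists S : {poly R}, [/\ (size S <= n.+1)%N,
      S^`() + lam%:P * S = y & forall x, a <= x <= b -> `|S.[x]| <= S.[a]]].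
  by apply: IHn; lra.
have A_gt0 : 0 < A by lra.
have leab : a <= b by exact: ltW.
pose y := jacobi_next A B z.
have ode_y : jacobi_ode n.+1 A B y by exact: jacobi_ode_next.
have ya : y.[a] = 1 by rewrite jacobi_next_a.
have yb : `|y.[b]| <= 1.
  rewrite jacobi_next_b// normrM mulr_ile1//; last by apply: z_le1; rewrite leab lexx.
  by rewrite normrM normfV (gtr0_norm A_gt0) ler_pdivrMr// mul1r ler_norml; lra.
have y_le1 x : a <= x <= b -> `|y.[x]| <= 1.
  move=> /(sonin A_ge B_ge (ltn0Sn n) ode_y) /le_trans; apply.
  by rewrite ge_max yb ya normr1 lexx.
exists y; split => //; first exact: size_jacobi_next.
move=> lam lam_gt0; have [S1 [sS1 S1E S1_le]] := Sz lam lam_gt0.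
set c : R := n.+1%:R * (n%:R + B) / (A * k).
have c_ge0 : 0 <= c.
  have n_ge0 : 0 <= n%:R :> R by rewrite ler0n.
  apply: divr_ge0; last by apply: mulr_ge0; exact: ltW.
  by apply: mulr_ge0; [rewrite ler0n|lra].
exists ((lam^-1)%:P * (y + c%:P * S1)); split.
- rewrite mul_polyC (leq_trans (size_scale_leq _ _))//.
  rewrite (leq_trans (size_polyD _ _))// geq_max size_jacobi_next//=.
  rewrite mul_polyC (leq_trans (size_scale_leq _ _))//; exact: leqW.
- rewrite !derivM !derivC mul0r add0r derivD derivM derivC mul0r add0r.
  rewrite (deriv_jacobi_next A_gt0 ode_z) -/c -S1E.
  have lam1 : lam%:P * (lam^-1)%:P = 1 :> {poly R}.
    by rewrite -polyCM mulfV ?gt_eqF.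
  rewrite (mulrA lam%:P) lam1 mul1r mulrDr.
  have -> : (lam^-1)%:P * (- c%:P * (S1^`() + lam%:P * S1)) =
    - ((lam^-1)%:P * (c%:P * S1^`())) - (lam%:P * (lam^-1)%:P) * (c%:P * S1) by ring.
  rewrite lam1; ring.
- have hE (p q : {poly R}) x :
      ((lam^-1)%:P * (p + c%:P * q)).[x] = lam^-1 * (p.[x] + c * q.[x]).
    by rewrite !hornerE.
  move=> x xab; rewrite !hE normrM (gtr0_norm (x := lam^-1)) ?invr_gt0//.
  rewrite ler_pM2l ?invr_gt0// (le_trans (ler_normD _ _))// ya.
  by rewrite lerD ?y_le1// normrM (ger0_norm c_ge0) ler_wpM2l// S1_le.
Qed.

End Jacobi.

(** * The lifting polynomial *)

Section Lifting.
Context {R : realType}.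
Variables (a b : R).
Hypothesis ltab : a < b.
Let k := b - a.
Let e : {poly R} := 'X - a%:P.
Let w : {poly R} := ('X - a%:P) * (b%:P - 'X).
Let k_gt0 : 0 < k. Proof. by rewrite subr_gt0. Qed.

Variables (r : nat) (y : {poly R}).
Hypothesis ode_y : jacobi_ode a b r 2 3 y.

Let mu : R := r%:R * (r%:R + 2).

Let odeE : w * y^`()^`() = - (((2 * k)%:P - 3%:P * e) * y^`() + mu%:P * y).
Proof.
have := ode_y; rewrite /jacobi_ode.
have -> : r%:R - 1 + 3 = r%:R + 2 :> R by ring.
by move=> ode; apply/eqP; rewrite -addr_eq0 addrA; apply/eqP.
Qed.

Let w' : w^`() = k%:P - 2%:P * e. Proof. exact: deriv_w. Qed.

(** The equation is [(w y')' + ((b - X) y)' + (r + 1)^2 y = 0], and the boundary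
    terms of its integral reduce to [- k y(a)]. *)
Lemma pint_jacobi : pint a b y = k * y.[a] / (r%:R + 1) ^+ 2.
Proof.
have r1 : (r%:R + 1 : R) != 0 by rewrite natr1 pnatr_eq0.
have : pint a b (w * y^`() + (b%:P - 'X) * y)^`() = - (k * y.[a]).
  by rewrite pint_deriv !hornerE /=; rewrite /k; ring.
have -> : (w * y^`() + (b%:P - 'X) * y)^`() = (- (r%:R + 1) ^+ 2) *: y.
  rewrite derivD (derivM w) (derivM (b%:P - 'X)) (derivB b%:P) derivC derivX w'.
  by rewrite odeE -mul_polyC /mu /k /e; ring.
by rewrite pintZ => intE; apply: (mulfI (expf_neq0 2 r1));
  rewrite -[LHS]opprK -mulNr intE; field.
Qed.

(** Orthogonality to polynomials of lower degree for the weight [x - a], by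
    induction on the degree: the operator [q |-> (rho q')' / (x - a)] is
    symmetric for this weight, has [y] as an eigenvector, and maps
    [(x - a)^(j+1)] to a combination of itself and [(x - a)^j] whose leading
    coefficient differs from the eigenvalue of [y]. *)
Lemma pint_jacobi_moment j : (j < r)%N -> pint a b (y * e ^+ j.+1) = 0.
Proof.
pose rho := e * w.
have rhoy : (rho * y^`())^`() = - mu%:P * (e * y).
  rewrite derivM (derivM e) w' /e derivB derivX derivC -/e.
  have -> : e * w * y^`()^`() = e * (w * y^`()^`()) by ring.
  by rewrite odeE /w /k /e; ring.
have rho0 q : pint a b (rho * q)^`() = 0.
  by rewrite pint_deriv !hornerE /=; ring.
elim: j => [|j IHj] ltjr.
  have := rho0 y^`(); rewrite rhoy -polyCN mul_polyC pintZ => /eqP.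
  rewrite mulf_eq0 oppr_eq0 mulf_eq0 -natrD !pnatr_eq0 addn2 orbF.
  by rewrite gtn_eqF//= mulrC => /eqP.
have {}IHj := IHj (ltnW ltjr).
have ej : (e ^+ j.+1)^`() = j.+1%:R%:P * e ^+ j.
  by rewrite deriv_exp /e derivB derivX derivC subr0 mul1r -/e /= -mulr_natl polyC_natr.
have := rho0 (y^`() * e ^+ j.+1 - (e ^+ j.+1)^`() * y).
have -> : rho * (y^`() * e ^+ j.+1 - (e ^+ j.+1)^`() * y) =
   rho * y^`() * e ^+ j.+1 - j.+1%:R%:P * (e ^+ j.+2 * (b%:P - 'X)) * y.
  by rewrite ej /rho /w -/e !exprS; ring.
have -> : (rho * y^`() * e ^+ j.+1 - j.+1%:R%:P * (e ^+ j.+2 * (b%:P - 'X)) * y)^`() =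
  (j.+1%:R * j.+3%:R - mu) *: (y * e ^+ j.+2)
    - (j.+1%:R * j.+2%:R * k) *: (y * e ^+ j.+1).
  have D3 (c : R) (p q s : {poly R}) : (c%:P * (p * q) * s)^`() =
      c%:P * (p^`() * q + p * q^`()) * s + c%:P * (p * q) * s^`().
    by rewrite !derivM derivC; ring.
  rewrite derivB (derivM (rho * y^`())) rhoy ej D3 (derivB b%:P) derivC derivX.
  have -> : (e ^+ j.+2)^`() = j.+2%:R%:P * e ^+ j.+1.
    by rewrite deriv_exp /e derivB derivX derivC subr0 mul1r -/e /= -mulr_natl
      polyC_natr.
  have -> : b%:P - 'X = k%:P - e by rewrite /k /e; ring.
  rewrite -!mul_polyC /rho (_ : w = e * (k%:P - e)); last by rewrite /w /k /e; ring.
  rewrite !exprS -[in j.+3%:R]natr1; ring.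
rewrite linearB /= !pintZ IHj mulr0 subr0 => /eqP; rewrite mulf_eq0 => /orP[|/eqP//].
rewrite subr_eq0 /mu -natrD -!natrM eqr_nat addn2 => /eqP; nia.
Qed.

Lemma pint_jacobi_orth (q : {poly R}) : (size q <= r)%N -> pint a b (y * e * q) = 0.
Proof.
suff orth j : (j + size q <= r)%N -> pint a b (y * e ^+ j.+1 * q) = 0.
  by move=> sq; have := orth 0%N; rewrite expr1; apply.
elim/poly_ind: q j => [|q c IHq] j; first by rewrite mulr0 linear0.
rewrite size_MXaddC; case: ifPn => [/andP[/eqP-> /eqP->] _|qc le_r].
  by rewrite mul0r add0r mulr0 linear0.
have -> : y * e ^+ j.+1 * (q * 'X + c%:P) = y * e ^+ j.+2 * q +
    a *: (y * e ^+ j.+1 * q) + c *: (y * e ^+ j.+1).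
  by rewrite -!mul_polyC !exprS /e; ring.
rewrite linearD linearD /= !pintZ IHq; last by move: le_r; lia.
rewrite IHq; last by move: le_r; lia.
rewrite pint_jacobi_moment ?mulr0 ?addr0//; move: le_r; lia.
Qed.

Lemma pint_jacobi_eval (q : {poly R}) : (size q <= r.+1)%N ->
  pint a b (y * q) = q.[a] * pint a b y.
Proof.
move=> sq; have /factor_theorem[q1 q1E] : root (q - q.[a]%:P) a.
  by rewrite /root !hornerE subrr.
have sq1 : (size q1 <= r)%N.
  have [->|q1N0] := eqVneq q1 0; first by rewrite size_poly0.
  have : (size (q1 * e)%R <= r.+1)%N.
    rewrite /e -q1E (leq_trans (size_polyD _ _))// geq_max sq size_polyN.
    by rewrite (leq_trans (size_polyC_leq1 _)).
  by rewrite size_Mmonic ?monicXsubC// size_XsubC addn2.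
have -> : y * q = q.[a] *: y + y * e * q1.
  have qE : q = q.[a]%:P + q1 * e by rewrite /e -q1E; ring.
  by rewrite -mul_polyC [in LHS]qE; ring.
by rewrite linearD /= pintZ pint_jacobi_orth// addr0.
Qed.

End Lifting.

(** The lifting polynomial is orthogonal to all [(x - a) q] with [q] of degree
    less than [r], so it is the Jacobi polynomial with [A = 2], [B = 3] up to a
    factor, which [pint_jacobi] determines. *)
Lemma lifting_exists (R : realType) (a b : R) (r : nat) : a < b ->
  exists chi : {poly R}, [/\ (size chi <= r.+1)%N,
    forall q : {poly R}, (size q <= r.+1)%N -> pint a b (chi * q) = q.[a],
    chi.[a] = (r%:R + 1) ^+ 2 / (b - a) &
    forall lam, 0 < lam -> exists S : {poly R}, [/\ (size S <= r.+1)%N,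
      S^`() + lam%:P * S = chi & forall x, a <= x <= b -> `|S.[x]| <= S.[a]]].
Proof.
move=> ltab; have k_gt0 : 0 < b - a by rewrite subr_gt0.
have [||||y [sy ode ya _ Sy]] := @jacobi_exists R a b ltab r 2 3; [lra..|].
pose c := (r%:R + 1) ^+ 2 / (b - a).
have r1 : 0 < r%:R + 1 :> R by rewrite natr1 ltr0n.
have c_gt0 : 0 < c by rewrite divr_gt0// exprn_gt0.
exists (c *: y); split.
- exact: leq_trans (size_scale_leq _ _) sy.
- move=> q sq; rewrite -scalerAl pintZ (pint_jacobi_eval ltab ode)//.
  rewrite (pint_jacobi ode) ya /c; field.
  by rewrite gt_eqF//= gt_eqF.
- by rewrite hornerZ ya mulr1.
- move=> lam lam_gt0; have [S [sS SE S_le]] := Sy lam lam_gt0.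
  exists (c *: S); split.
  + exact: leq_trans (size_scale_leq _ _) sS.
  + by rewrite derivZ -SE -!mul_polyC; ring.
  + move=> x xab; rewrite !hornerZ normrM (gtr0_norm c_gt0) ler_pM2l//.
    exact: S_le.
Qed.

(** * The scalar scheme *)

Section ScalarScheme.
Context {R : realType}.
Variables (a b : R).
Hypothesis ltab : a < b.
Let k := b - a.
Let k_gt0 : 0 < k. Proof. by rewrite subr_gt0. Qed.
Local Notation I := (pint a b).

Definition is_lifting (r : nat) (chi : {poly R}) : Prop :=
  (size chi <= r.+1)%N /\
  forall q : {poly R}, (size q <= r.+1)%N -> I (chi * q) = q.[a].

Definition dG_residual (chi : {poly R}) (lam g : R) (p : {poly R}) : {poly R} :=
  p^`() + lam *: p + (p.[a] - g) *: chi.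

Lemma pint_deriv_mul (v : {poly R}) :
  I (v^`() * v) = (v.[b] ^+ 2 - v.[a] ^+ 2) / 2.
Proof.
have -> : v^`() * v = 2^-1 *: (v ^+ 2)^`().
  have -> : (v ^+ 2)^`() = 2 *: (v^`() * v).
    by rewrite expr2 derivM -mul_polyC; ring.
  by rewrite scalerA mulVf ?scale1r// pnatr_eq0.
by rewrite pintZ pint_deriv !horner_exp mulrC.
Qed.

Lemma pint_sqrD (p q : {poly R}) :
  I ((p + q) ^+ 2) = I (p ^+ 2) + 2 * I (p * q) + I (q ^+ 2).
Proof.
have -> : (p + q) ^+ 2 = p ^+ 2 + 2 *: (p * q) + q ^+ 2 by rewrite -mul_polyC; ring.
by rewrite !linearD /= pintZ.
Qed.

Lemma size_deriv_le (v : {poly R}) n : (size v <= n.+1)%N -> (size v^`() <= n)%N.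
Proof.
have [->|vN0] := eqVneq v 0; first by rewrite deriv0 size_poly0.
by move=> sv; rewrite -ltnS (leq_trans (lt_size_deriv vN0)).
Qed.

(** The residual of [v] is [H + lam v] with [H = v' + v(a) chi]. Testing [H] with
    [v] gives [2 int (H v) = v(a)^2 + v(b)^2], so the squared norm of the residual
    is at least [||H||^2 + lam v(a)^2]. The derivative [v'] has degree less than
    [r] and sees only the lifting polynomial of that degree, written [chi']; since
    [||v' + v(a) chi'|| >= 0], one gets
    [||H||^2 >= v(a)^2 (chi(a) - chi'(a)) = v(a)^2 (2 r + 1) / k]. *)
Lemma trace_bound r chi lam (v : {poly R}) : is_lifting r chi ->
  chi.[a] = (r%:R + 1) ^+ 2 / k -> 0 <= lam -> (size v <= r.+1)%N ->
  v.[a] ^+ 2 * ((2 * r%:R + 1) / k + lam) <= I (dG_residual chi lam 0 v ^+ 2).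
Proof.
move=> [schi chiE] chia lam_ge0 sv.
(* For r = 0 the space of degree less than r is zero, with lifting 0. *)
have [chi' [chi'E chi'a]] : exists chi' : {poly R},
    (forall q : {poly R}, (size q <= r)%N -> I (chi' * q) = q.[a]) /\
    chi'.[a] = r%:R ^+ 2 / k /\ (size chi' <= r)%N.
  case: r schi chiE chia sv => [|n] _ _ _ _.
    exists 0; split; last by rewrite horner0 expr0n mul0r size_poly0.
    by move=> q; rewrite leqn0 size_poly_eq0 => /eqP->; rewrite mul0r linear0 horner0.
  have [chi' [sc cE ca _]] := @lifting_exists R a b n ltab.
  by exists chi'; split => //; rewrite ca natr1.
case: chi'a => chi'a schi'.
have sv' := size_deriv_le sv.
set H := v^`() + v.[a] *: chi.
have IH : I (H ^+ 2) = I (v^`() ^+ 2) + 2 * (v.[a] * v^`().[a]) + v.[a] ^+ 2 * chi.[a].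
  rewrite /H pint_sqrD -scalerAr pintZ (mulrC _ chi) chiE; last exact: leqW.
  by rewrite exprZn pintZ expr2 expr2 chiE// -expr2 mulrA.
have IH' : 0 <= I (v^`() ^+ 2) + 2 * (v.[a] * v^`().[a]) + v.[a] ^+ 2 * chi'.[a].
  have := pint_sqr_ge0 ltab (v^`() + v.[a] *: chi').
  rewrite pint_sqrD -scalerAr pintZ (mulrC _ chi') chi'E//.
  by rewrite exprZn pintZ (expr2 chi') chi'E.
have IHv : I (H * v) = (v.[a] ^+ 2 + v.[b] ^+ 2) / 2.
  by rewrite mulrDl linearD /= pint_deriv_mul -scalerAl pintZ chiE//; field.
have -> : dG_residual chi lam 0 v = H + lam *: v.
  by rewrite /dG_residual subr0 /H addrAC.
rewrite pint_sqrD -scalerAr pintZ IHv.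
have : 0 <= I ((lam *: v) ^+ 2) by exact: pint_sqr_ge0.
have : 0 <= lam * v.[b] ^+ 2 by rewrite mulr_ge0 ?sqr_ge0.
have -> : (2 * r%:R + 1) / k = chi.[a] - chi'.[a].
  by rewrite chia chi'a; field; rewrite gt_eqF.
rewrite IH; lra.
Qed.

Lemma is_derive_expR_affine (c s x : R) :
  is_derive x (1 : R) (fun x : R => expR (c * (x - s)) : R) (expR (c * (x - s)) * c).
Proof.
have dl : is_derive x (1 : R) (fun x : R => c * (x - s) : R) c.
  by apply: trigger_derive; rewrite /GRing.scale /=; ring.
exact: (@is_derive1_comp R expR (fun x : R => c * (x - s) : R) x _ _
  (is_derive_expR _) dl).
Qed.

(** [z(s)] is the integral of [exp(- lam (s - x)) P(x)] over [a, s], so this is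
    the Cauchy-Schwarz inequality. The proof uses Young's inequality
    [|P| <= (th + P^2 / th) / 2] with a free parameter under the derivative, and
    then chooses [th = |z(s)| / k]. *)
Lemma damped_bound (z : R -> R) (P : {poly R}) (lam : R) : 0 <= lam ->
  (forall x : R, is_derive x (1 : R) z (P.[x] - lam * z x)) -> z a = 0 ->
  forall s, a <= s <= b -> z s ^+ 2 <= k * I (P ^+ 2).
Proof.
move=> lam_ge0 dz za s /andP[as_ sb].
set J := I _.
suff le_z (th : R) : 0 < th -> forall (z : R -> R) (P' : {poly R}), P' ^+ 2 = P ^+ 2 ->
    (forall x : R, is_derive x (1 : R) z (P'.[x] - lam * z x)) -> z a = 0 ->
    z s <= (th * k + J / th) / 2.
  have le_nz (th : R) : 0 < th -> `|z s| <= (th * k + J / th) / 2.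
    move=> th_gt0; rewrite ler_norml lerNl; apply/andP; split;
      last exact: (le_z th th_gt0 z P).
    apply: (le_z th th_gt0 (fun x => - z x) (- P)); first by rewrite sqrrN.
      move=> x; have := dz x => dzx.
      by apply: trigger_derive; rewrite hornerN; ring.
    by rewrite za oppr0.
  have J_ge0 : 0 <= J by exact: pint_sqr_ge0.
  have [->|zN0] := eqVneq (z s) 0; first by rewrite expr0n mulr_ge0// ltW.
  have nz_gt0 : 0 < `|z s| by rewrite normr_gt0.
  have := le_nz (`|z s| / k) (divr_gt0 nz_gt0 k_gt0).
  have -> : (`|z s| / k * k + J / (`|z s| / k)) / 2 = (`|z s| + J * k / `|z s|) / 2.
    by field; rewrite !gt_eqF.
  rewrite -(ler_pM2r nz_gt0).
  have -> : (`|z s| + J * k / `|z s|) / 2 * `|z s| = (`|z s| ^+ 2 + J * k) / 2.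
    by field; rewrite gt_eqF.
  rewrite -expr2 real_normK ?num_real//; lra.
move=> th_gt0 {}z P' P'2 {}dz {}za.
pose Q := prim (P ^+ 2).
pose h x := expR (lam * (x - s)) * z x - (th * x + Q.[x] / th) / 2.
have dh (x : R) : is_derive x (1 : R) h
    (expR (lam * (x - s)) * P'.[x] - (th + P.[x] ^+ 2 / th) / 2).
  have dzx := dz x.
  have dQ : is_derive x (1 : R) (horner Q) (P.[x] ^+ 2).
    by rewrite -horner_exp -[P ^+ 2]deriv_prim; exact: is_derive_poly.
  have de := is_derive_expR_affine lam s x.
  apply: trigger_derive; rewrite /GRing.scale /=; field.
  by rewrite gt_eqF.
have h_le : h s <= h a.
  apply: (@ler0_derive1_nincr _ h a s) => //.
  - move=> x; rewrite in_itv /= => /andP[ax xs].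
    have dhx := dh x; rewrite derive1E derive_val subr_le0.
    have p2 : P.[x] ^+ 2 = `|P'.[x]| ^+ 2.
      by rewrite real_normK ?num_real// -!horner_exp P'2.
    apply: (@le_trans _ _ `|P'.[x]|).
      apply: le_trans (ler_norm _) _; rewrite normrM gtr0_norm ?expR_gt0//.
      rewrite ler_piMl// expR_le1 mulr_ge0_le0//; lra.
    have th_sq : 0 <= (th - `|P'.[x]|) ^+ 2 by exact: sqr_ge0.
    rewrite -(ler_pM2r th_gt0) p2.
    have -> : (th + `|P'.[x]| ^+ 2 / th) / 2 * th = (th ^+ 2 + `|P'.[x]| ^+ 2) / 2.
      by field; rewrite gt_eqF.
    by move: th_sq; rewrite sqrrB; lra.
  - by apply: derivable_within_continuous => x _; case: (dh x).
have QsJ : Q.[s] - Q.[a] <= J.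
  rewrite lerB// (@poly_nondecreasing _ Q a b)// => x _.
  by rewrite /Q deriv_prim horner_exp sqr_ge0.
move: h_le; rewrite /h subrr mulr0 expR0 mul1r za mulr0 => h_le.
have : z s <= (th * (s - a) + (Q.[s] - Q.[a]) / th) / 2.
  by rewrite mulrBr mulrBl; lra.
move=> /le_trans; apply; rewrite ler_pM2r ?invr_gt0//; apply: lerD.
  by rewrite ler_pM2l// /k lerB.
by rewrite ler_pM2r ?invr_gt0.
Qed.

Lemma size_dG_residual r chi lam g (p : {poly R}) : is_lifting r chi ->
  (size p <= r.+1)%N -> (size (dG_residual chi lam g p) <= r.+1)%N.
Proof.
move=> [schi _] sp; rewrite /dG_residual.
rewrite (leq_trans (size_polyD _ _))// geq_max (leq_trans (size_scale_leq _ _))// andbT.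
rewrite (leq_trans (size_polyD _ _))// geq_max (leq_trans (size_scale_leq _ _))// andbT.
exact/leqW/size_deriv_le.
Qed.

Lemma pint_dG_residual r chi lam g (p q : {poly R}) : is_lifting r chi ->
  (size q <= r.+1)%N ->
  I (dG_residual chi lam g p * q) =
  I ((p^`() + lam *: p) * q) + (p.[a] - g) * q.[a].
Proof.
move=> [_ chiE] sq; rewrite /dG_residual mulrDl linearD /=.
by rewrite -(scalerAl _ chi) pintZ chiE.
Qed.

Lemma lifting_at_a r : exists chi : {poly R}, is_lifting r chi /\
  chi.[a] = (r%:R + 1) ^+ 2 / k.
Proof.
by have [chi [s1 s2 s3 _]] := @lifting_exists R a b r ltab; exists chi.
Qed.

(** Uniqueness for the scalar scheme: the residual of a solution with zero data
    is orthogonal to P^r, hence has norm zero; then [trace_bound] and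
    [damped_bound] apply. *)
Lemma dG_homogeneous_eq0 r lam (d : {poly R}) : 0 <= lam -> (size d <= r.+1)%N ->
  (forall q : {poly R}, (size q <= r.+1)%N ->
     I ((d^`() + lam *: d) * q) + d.[a] * q.[a] = 0) ->
  forall s, a <= s <= b -> d.[s] = 0.
Proof.
move=> lam_ge0 sd d_eq s sab; have [chi [chiL chia]] := lifting_at_a r.
have P2 : I (dG_residual chi lam 0 d ^+ 2) = 0.
  by rewrite expr2 (pint_dG_residual _ _ _ chiL) ?subr0 ?d_eq// size_dG_residual.
have da : d.[a] = 0.
  have := trace_bound chiL chia lam_ge0 sd; rewrite P2.
  rewrite pmulr_lle0; last first.
    by rewrite ltr_wpDr// divr_gt0// ltr_wpDl// mulr_ge0.
  by move=> d2; apply/eqP; rewrite -sqrf_eq0 eq_le d2 sqr_ge0.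
have := @damped_bound (horner d) (dG_residual chi lam 0 d) lam lam_ge0 _ da s sab.
rewrite P2 mulr0 => d2; apply/eqP; rewrite -sqrf_eq0 eq_le sqr_ge0 andbT; apply: d2.
move=> x; apply: trigger_derive; rewrite /dG_residual da subrr scale0r addr0.
by rewrite hornerD hornerZ addrK.
Qed.

(** If [S' + lam S = chi], then [psi = S / (1 + S(a))] has
    [psi' + lam psi = (1 - psi(a)) chi], which is the scheme with initial value 1
    tested in strong form. *)
Lemma dG_psiE r chi lam (S : {poly R}) : 0 < lam -> is_lifting r chi ->
  (size S <= r.+1)%N -> S^`() + lam *: S = chi -> 0 <= S.[a] ->
  forall s, a <= s <= b -> (dG_psi lam r a b).[s] = S.[s] / (1 + S.[a]).
Proof.
move=> lam_gt0 chiL sS SE Sa_ge0 s sab.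
have c_gt0 : 0 < 1 + S.[a] by rewrite ltr_pwDl.
set c := (1 + S.[a])^-1.
have formE (p q : {poly R}) :
    (\int[lebesgue_measure]_(s in `]a, b]) ((p^`().[s] + lam * p.[s]) * q.[s]))%R =
    I ((p^`() + lam *: p) * q).
  by apply: (Rintegral_eq_pint ltab) => x _; rewrite hornerM hornerD hornerZ.
have [spsi psiE] : (size (dG_psi lam r a b) <= r.+1)%N /\
    forall q : {poly R}, (size q <= r.+1)%N ->
    I (((dG_psi lam r a b)^`() + lam *: dG_psi lam r a b) * q)
        + (dG_psi lam r a b).[a] * q.[a] = q.[a].
  pose P := [set p : {poly R} | (size p <= r.+1)%N /\
    forall q : {poly R}, (size q <= r.+1)%N ->
      (\int[lebesgue_measure]_(s in `]a, b]) ((p^`().[s] + lam * p.[s]) * q.[s])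
        + p.[a] * q.[a])%R = q.[a]].
  have : P (dG_psi lam r a b).
    apply: xgetPex; exists (c *: S); split.
      exact: leq_trans (size_scale_leq _ _) sS.
    move=> q sq; rewrite formE derivZ.
    have -> : c *: S^`() + lam *: (c *: S) = c *: chi.
      by rewrite -SE -!mul_polyC; ring.
    rewrite -scalerAl pintZ chiL.2// hornerZ /c; field.
    by rewrite gt_eqF.
  by move=> [sp pE]; split => // q sq; rewrite -[RHS](pE q sq) formE.
rewrite -/c mulrC -hornerZ; apply/eqP; rewrite -subr_eq0 -hornerN -hornerD; apply/eqP.
apply: (@dG_homogeneous_eq0 r lam _ (ltW lam_gt0)) sab.
  rewrite (leq_trans (size_polyD _ _))// geq_max spsi size_polyN.
  by rewrite (leq_trans (size_scale_leq _ _)).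
move=> q sq.
have -> : (dG_psi lam r a b - c *: S)^`() + lam *: (dG_psi lam r a b - c *: S) =
    (dG_psi lam r a b)^`() + lam *: dG_psi lam r a b - c *: chi.
  by rewrite derivB derivZ -SE -!mul_polyC; ring.
rewrite mulrBl linearB /= -(scalerAl _ chi) pintZ chiL.2//.
rewrite hornerD hornerN hornerZ.
have := psiE q sq; set X := I _ => XE.
have -> : X = q.[a] - (dG_psi lam r a b).[a] * q.[a] by move: XE; lra.
by rewrite /c; field; rewrite gt_eqF.
Qed.

End ScalarScheme.

(** * The scalar maximum norm estimate *)

Lemma ae_itv_exists (R : realType) (P : R -> Prop) (c d : R) : c < d ->
  {ae lebesgue_measure, forall x : R, P x} -> exists2 x : R, c < x < d & P x.
Proof.
move=> ltcd [N [mN N0 subN]]; apply/not_exists2P => noP.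
have cdN : `]c, d[%classic `<=` N.
  move=> x; rewrite /= in_itv /= => xcd; apply: subN => /= Px.
  by case: (noP x).
have : (lebesgue_measure `]c, d[%classic <= lebesgue_measure N)%E.
  by apply: le_measure => //; rewrite inE//; exact: measurable_itv.
rewrite N0 lebesgue_measure_itv /= lte_fin ltcd -EFinB lee_fin; lra.
Qed.

Lemma lebesgue_measureT_gt0 (R : realType) :
  (0 < @lebesgue_measure R [set: R])%E.
Proof.
apply: (@lt_le_trans _ _ (lebesgue_measure `]0%R, 1%R[%classic)).
  by rewrite lebesgue_measure_itv /= lte_fin ltr01 -EFinB lte_fin; lra.
by apply: le_measure => //; rewrite inE//; exact: measurable_itv.
Qed.

Lemma Linf_normE (R : realType) (V : completeNormedModType R) (D : set R) (g : R -> V) :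
  Linf_norm D g = ess_sup lebesgue_measure (abse \o (EFin \o ((fun s => `|g s|) \_ D))).
Proof. by rewrite /Linf_norm unlock lebesgue_measureT_gt0. Qed.

Lemma Linf_norm_le (R : realType) (V : completeNormedModType R) (D : set R)
    (g : R -> V) (c : R) :
  0 <= c -> (forall s, D s -> `|g s| <= c) -> (Linf_norm D g <= c%:E)%E.
Proof.
move=> c_ge0 g_le; rewrite Linf_normE; apply/ess_supP; apply: nearW => s /=.
rewrite lee_fin patchE; case: ifPn => [/set_mem Ds|_]; last by rewrite normr0.
by rewrite normr_id g_le.
Qed.

(** Where [|g|] exceeds its essential supremum, it does so on an interval to the
    left of the point, by continuity, and such an interval is not negligible. *)
Lemma continuous_le_Linf_norm (R : realType) (g : R -> R) (a b : R) : a < b ->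
  continuous g -> forall s, a < s <= b ->
  `|g s| <= fine (Linf_norm (V := R^o) `]a, b] g).
Proof.
move=> ltab cg s /andP[as_ sb].
have gM : Linf_norm (V := R^o) `]a, b] g \is a fin_num.
  have [|M _ gM] := @EVT_max R (fun s => `|g s|) a b (ltW ltab).
    by apply: continuous_subspaceT => x; apply: continuous_comp;
      [exact: cg|exact: norm_continuous].
  rewrite ge0_fin_numE ?Lnorm_ge0//; apply: le_lt_trans (ltry (`|g M|)).
  apply: Linf_norm_le => // x; rewrite /= in_itv /= => /andP[ax xb].
  by apply: gM; rewrite in_itv /= (ltW ax).
rewrite leNgt; apply/negP => lt_g.
have [e /= e_gt0 eP] : \forall x \near s,
    fine (Linf_norm (V := R^o) `]a, b] g) < `|g x|.
  have cng : (fun x => `|g x|) @ s --> `|g s|.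
    by apply: continuous_comp; [exact: cg|exact: norm_continuous].
  exact: (cvgr_gt _ cng).
have := ess_sup_ge lebesgue_measure (abse \o (EFin \o ((fun s => `|g s|) \_ `]a, b]))).
rewrite -(@Linf_normE R R^o).
move=> /(@ae_itv_exists R _ (Num.max a (s - e)) s); case.
  by rewrite gt_max as_ ltrBlDr ltrDl.
move=> x /andP[]; rewrite gt_max => /andP[ax sex] xs.
rewrite /= patchE ifT; last first.
  by rewrite inE /= in_itv /= ax (le_trans (ltW xs)).
rewrite normr_id -(fineK gM) lee_fin leNgt => /negP; apply; apply: eP => /=.
by rewrite ltr_distlC ltrBlDr -ltrBlDr sex /= (lt_trans xs)// ltrDl.
Qed.

Section ScalarBound.
Context {R : realType}.
Variables (a b : R).
Hypothesis ltab : a < b.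
Let k := b - a.
Let k_gt0 : 0 < k. Proof. by rewrite subr_gt0. Qed.
Local Notation I := (pint a b).

(** The residual of [v = p - g psi] with initial value 0 is that of [p] with
    initial value [g], and [v = v(a) eps + z] with [z] driven by this residual. *)
Lemma dG_scalar_bound r : exists2 chi : {poly R}, is_lifting a b r chi &
  forall (lam g : R) (p : {poly R}), 0 < lam -> (size p <= r.+1)%N ->
  forall s, a < s <= b ->
  `|p.[s]| <= `|g| + C_scalar lam r a b *
     Num.sqrt (k * I (dG_residual a chi lam g p ^+ 2)).
Proof.
have [chi [schi chiE chia chiS]] := @lifting_exists R a b r ltab.
have chiL : is_lifting a b r chi by split.
exists chi => // lam g p lam_gt0 sp s /andP[as_ sb].
have lam_ge0 := ltW lam_gt0; have leab := ltW ltab.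
have [S [sS SE S_le]] := chiS lam lam_gt0.
rewrite mul_polyC in SE.
have Sa_ge0 : 0 <= S.[a] by apply: le_trans (S_le a _); rewrite ?normr_ge0// lexx.
have c_gt0 : 0 < 1 + S.[a] by rewrite ltr_pwDl.
have psiE x : a <= x <= b -> (dG_psi lam r a b).[x] = S.[x] / (1 + S.[a]).
  exact: (dG_psiE ltab lam_gt0 chiL sS SE Sa_ge0).
set psi := (1 + S.[a])^-1 *: S.
have psi_le1 x : a <= x <= b -> `|psi.[x]| <= 1.
  move=> xab; rewrite hornerZ normrM gtr0_norm ?invr_gt0// ler_pdivrMl// mulr1.
  by apply: le_trans (S_le x xab) _; rewrite lerDr.
have psia : 1 - psi.[a] = (1 + S.[a])^-1.
  by rewrite hornerZ; field; rewrite gt_eqF.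
have psi' : psi^`() + lam *: psi = (1 - psi.[a]) *: chi.
  by rewrite psia /psi derivZ -SE -!mul_polyC; ring.
pose v := p - g *: psi.
set P := dG_residual a chi lam g p.
have PE : P = dG_residual a chi lam 0 v.
  rewrite /P /dG_residual /v derivB derivZ hornerD hornerN hornerZ.
  have -> : p^`() - g *: psi^`() + lam *: (p - g *: psi) =
     p^`() + lam *: p - g *: (psi^`() + lam *: psi) by rewrite -!mul_polyC; ring.
  by rewrite psi' -!mul_polyC; ring.
have sv : (size v <= r.+1)%N.
  rewrite (leq_trans (size_polyD _ _))// geq_max sp size_polyN.
  by rewrite !(leq_trans (size_scale_leq _ _)).
have vE : v.[s] = p.[s] - g * psi.[s] by rewrite hornerD hornerN hornerZ.
clearbody v; set J := I (P ^+ 2).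
have J_ge0 : 0 <= J by exact: pint_sqr_ge0.
have kJ_ge0 : 0 <= k * J by rewrite mulr_ge0// ltW.
have va_le : `|v.[a]| <= Upsilon r (k * lam) * Num.sqrt (k * J).
  have tb := trace_bound ltab chiL chia lam_ge0 sv; rewrite -PE -/J in tb.
  have r_ge0 : 0 <= r%:R :> R by exact: ler0n.
  have kl_gt0 : 0 < k * lam by rewrite mulr_gt0.
  have D_gt0 : 0 < 2 * r%:R + 1 + k * lam by lra.
  have U_ge0 : 0 <= 3 / (2 * (2 * r%:R + 1) + k * lam) by apply: divr_ge0; lra.
  rewrite -sqrtrM// -sqrtr_sqr ler_wsqrtr//.
  have va2 : v.[a] ^+ 2 <= k * J / (2 * r%:R + 1 + k * lam).
    rewrite ler_pdivlMr//.
    apply: le_trans (_ : k * (v.[a] ^+ 2 * ((2 * r%:R + 1) / k + lam)) <= _).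
      by rewrite le_eqVlt; apply/orP; left; apply/eqP; field; rewrite gt_eqF.
    by rewrite ler_pM2l.
  apply: le_trans va2 _; rewrite [leRHS]mulrC ler_wpM2l//.
  by rewrite ler_pdivlMr ?ler_pdivrMl//; lra.
pose eps x := (expR (- lam * (x - a)) - psi.[x]) / (1 - psi.[a]).
pose z x := v.[x] - v.[a] * eps x.
have psia_neq0 : 1 - psi.[a] != 0 by rewrite psia invr_eq0 gt_eqF.
have de (x : R) : is_derive x (1 : R) eps (- (lam * eps x) - chi.[x]).
  have dexp := is_derive_expR_affine (- lam) a x.
  have psi'x : psi^`().[x] = (1 - psi.[a]) * chi.[x] - lam * psi.[x].
    have := congr1 (fun q => q.[x]) psi'.
    by rewrite hornerD !hornerZ -/psi => <-; rewrite addrK.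
  by apply: trigger_derive; rewrite /GRing.scale /= psi'x /eps; field.
have dz (x : R) : is_derive x (1 : R) z (P.[x] - lam * z x).
  have dex := de x.
  apply: trigger_derive; rewrite PE /z /dG_residual /GRing.scale /=.
  by rewrite !hornerD !hornerZ subr0; ring.
have za : z a = 0.
  by rewrite /z /eps subrr mulr0 expR0; field.
have z_le : `|z s| <= Num.sqrt (k * J).
  rewrite -sqrtr_sqr ler_wsqrtr//.
  by apply: (damped_bound ltab lam_ge0 dz za); rewrite (ltW as_).
have eps_le : `|eps s| <= fine (Linf_norm (V := R^o) `]a, b]
            (fun s => dG_err lam r a b s / dG_err lam r a b a)).
  have errE x : a <= x <= b -> dG_err lam r a b x = expR (- lam * (x - a)) - psi.[x].
    by move=> xab; rewrite /dG_err psiE// hornerZ [_ / _]mulrC.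
  have -> : eps s = dG_err lam r a b s / dG_err lam r a b a.
    by rewrite !errE ?lexx ?leab ?(ltW as_)// subrr mulr0 expR0.
  apply: (@continuous_le_Linf_norm R
    (fun s => dG_err lam r a b s / dG_err lam r a b a) a b ltab); last by rewrite as_.
  move=> x; apply: cvgMl; apply: cvgB; last exact: continuous_horner.
  have [dex _] := is_derive_expR_affine (- lam) a x.
  by have /derivable1_diffP/differentiable_continuous := dex.
have -> : p.[s] = g * psi.[s] + (v.[a] * eps s + z s).
  by rewrite /z vE; ring.
apply: le_trans (ler_normD _ _) _; apply: lerD.
  by rewrite normrM ler_piMr// psi_le1// (ltW as_).
apply: le_trans (ler_normD _ _) _; rewrite /C_scalar mulrDl mul1r; apply: lerD => //.
rewrite normrM -/k mulrAC; apply: ler_pM => //.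
Qed.

End ScalarBound.

(** * Real symmetric matrices *)

Section RealSymmetric.
Import sesquilinear.
Local Open Scope complex_scope.
Local Open Scope sesquilinear_scope.
Context {R : realType}.

Lemma Re_mulr_real (z : R[i]) (x : R) : complex.Re (z * x%:C) = complex.Re z * x.
Proof. by case: z => u v /=; rewrite mulr0 subr0. Qed.

Lemma Im_mulr_real (z : R[i]) (x : R) : complex.Im (z * x%:C) = complex.Im z * x.
Proof. by case: z => u v /=; rewrite mulr0 add0r. Qed.

Lemma Re_sum (I : finType) (F : I -> R[i]) :
  complex.Re (\sum_i F i) = \sum_i complex.Re (F i).
Proof. by apply: big_morph => // -[u v] [u' v']. Qed.

Lemma Im_sum (I : finType) (F : I -> R[i]) :
  complex.Im (\sum_i F i) = \sum_i complex.Im (F i).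
Proof. by apply: big_morph => // -[u v] [u' v']. Qed.

(** If the rows [P_j] of a unitary matrix diagonalize [S] over the complex
    numbers, the real and imaginary parts of [P_j] are real left eigenvectors of
    [S], as the eigenvalues are real, and the two sums of squares of their
    products with [x] add up to [|P x|^2 = |x|^2]. *)
Lemma symmetric_parseval_frame d (S : 'M[R]_d) : S^T = S ->
  exists (q : 'I_d + 'I_d -> 'rV[R]_d) (lam : 'I_d + 'I_d -> R),
    (forall j, q j *m S = lam j *: q j) /\
    forall x : 'cV[R]_d, \sum_j (q j *m x) 0 0 ^+ 2 = \sum_i x i 0 ^+ 2.
Proof.
move=> S_sym; pose SC : 'M[R[i]]_d := map_mx (real_complex R) S.
have realC (x : R) : x%:C \is Num.real by apply/complex_realP; exists x.
have SC_herm : SC \is hermsymmx.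
  apply: realsym_hermsym; last by apply/mxOverP => i j; rewrite mxE.
  by apply/is_hermitianmxP; rewrite expr0 scale1r /SC map_mx_id// map_trmx S_sym.
have /orthomx_spectralP SCE := hermitian_normalmx SC_herm.
set P := spectralmx SC in SCE; set sp := spectral_diag SC in SCE.
have Pu : P \is unitarymx by exact: spectral_unitarymx.
have sp_real : sp \is a realmx by exact: hermitian_spectral_diag_real.
have PSC : P *m SC = diag_mx sp *m P.
  by rewrite [in LHS]SCE !mulmxA mulmxV ?mul1mx// unitarymx_unit.
pose lam j := complex.Re (sp 0 j).
have lamE j : sp 0 j = (lam j)%:C by rewrite RRe_real//; exact: mxOverP.
have PSCE j i : \sum_l P j l * (S l i)%:C = P j i * (lam j)%:C.
  have := congr1 (fun M : 'M[R[i]]_d => M j i) PSC; rewrite !mxE.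
  under eq_bigr do rewrite mxE; move=> ->.
  rewrite (bigD1 j)//= big1 ?addr0 => [|l lj].
    by rewrite mxE eqxx mulr1n lamE mulrC.
  by rewrite mxE eq_sym (negbTE lj) mulr0n mul0r.
exists (fun j => match j with
  | inl j => \row_i complex.Re (P j i) | inr j => \row_i complex.Im (P j i) end).
exists (fun j => match j with inl j => lam j | inr j => lam j end); split.
  case=> j; apply/rowP => i; rewrite !mxE.
    have := congr1 (@complex.Re R) (PSCE j i); rewrite Re_sum Re_mulr_real mulrC => <-.
    by apply: eq_bigr => l _; rewrite mxE Re_mulr_real.
  have := congr1 (@complex.Im R) (PSCE j i); rewrite Im_sum Im_mulr_real mulrC => <-.
  by apply: eq_bigr => l _; rewrite mxE Im_mulr_real.
move=> x; pose xC : 'cV[R[i]]_d := map_mx (real_complex R) x.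
pose y := P *m xC.
have yE j : y j 0 = \sum_i P j i * ((x i 0)%:C).
  by rewrite mxE; apply: eq_bigr => i _; rewrite mxE.
apply: (@complexI R); rewrite big_sumType /=.
transitivity (\sum_j `|y j 0| ^+ 2).
  rewrite -big_split /= rmorph_sum; apply: eq_bigr => j _ /=.
  rewrite -add_Re2_Im2 yE Re_sum Im_sum; congr (_%:C).
  congr (_ ^+ 2 + _ ^+ 2); rewrite mxE; apply: eq_bigr => i _; rewrite mxE.
    by rewrite Re_mulr_real.
  by rewrite Im_mulr_real.
transitivity ((y^t* *m y) 0 0).
  by rewrite mxE; apply: eq_bigr => j _; rewrite !mxE normCK mulrC.
have PP : P^t* *m P = 1%:M by apply: mulmx1C; apply/unitarymxP.
rewrite /y trmx_mul map_mxM -mulmxA (mulmxA _ P) PP mul1mx mxE rmorph_sum.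
apply: eq_bigr => i _ /=; rewrite !mxE (CrealP (realC _)).
by rewrite -expr2 -rmorphXn.
Qed.

End RealSymmetric.

(** * Parseval frames of eigenvectors *)

Section InnerProduct.
Context {R : realType} {H : completeNormedModType R}.
Variable dotH : {dot H for idfun}.
Hypothesis dotH_norm : induces_norm dotH.

Lemma dotC x y : dotH x y = dotH y x.
Proof. by rewrite hermC /= expr0 mul1r. Qed.

Lemma dotDl x y z : dotH (x + y) z = dotH x z + dotH y z.
Proof. by rewrite linearDl. Qed.

Lemma dotZl c x z : dotH (c *: x) z = c * dotH x z.
Proof. by rewrite linearZl_LR. Qed.

Lemma dot0l z : dotH 0 z = 0.
Proof. by rewrite -(scale0r 0) dotZl mul0r. Qed.

Lemma dotBl x y z : dotH (x - y) z = dotH x z - dotH y z.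
Proof. by rewrite dotDl -scaleN1r dotZl mulN1r. Qed.

Lemma dot_suml (I : Type) (s : seq I) (P : pred I) (F : I -> H) z :
  dotH (\sum_(i <- s | P i) F i) z = \sum_(i <- s | P i) dotH (F i) z.
Proof. by apply: (big_morph (dotH^~ z)); [move=> x y; exact: dotDl|exact: dot0l]. Qed.

Lemma dotZr c x z : dotH z (c *: x) = c * dotH z x.
Proof. by rewrite !(dotC z) dotZl. Qed.

Lemma dot_sumr (I : Type) (s : seq I) (P : pred I) (F : I -> H) z :
  dotH z (\sum_(i <- s | P i) F i) = \sum_(i <- s | P i) dotH z (F i).
Proof. by rewrite dotC dot_suml; apply: eq_bigr => i _; rewrite dotC. Qed.

Lemma dot_ge0 x : 0 <= dotH x x.
Proof.
have [->|x0] := eqVneq x 0; first by rewrite dot0l.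
by rewrite ltW// neq0_dnorm_gt0.
Qed.

Lemma sqr_norm_dot x : `|x| ^+ 2 = dotH x x.
Proof. by rewrite dotH_norm sqr_sqrtr// dot_ge0. Qed.

Lemma dot_le_norm x y : `|dotH x y| <= `|x| * `|y|.
Proof.
have [y0|yN0] := eqVneq `|y| 0.
  have -> : y = 0 by apply/eqP; rewrite -normr_eq0 y0.
  by rewrite dotC dot0l !normr0 mulr0.
rewrite -ler_sqr ?nnegrE ?mulr_ge0//.
rewrite real_normK ?num_real// exprMn !sqr_norm_dot.
have yy_gt0 : 0 < dotH y y by rewrite -sqr_norm_dot exprn_gt0// lt_def yN0 normr_ge0.
have := dot_ge0 (dotH y y *: x - dotH x y *: y).
rewrite dotBl !dotZl.
rewrite !(dotC _ (_ - _)) !dotBl !dotZl (dotC y x).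
have -> : dotH y y * (dotH y y * dotH x x - dotH x y * dotH x y) -
  dotH x y * (dotH y y * dotH x y - dotH x y * dotH y y) =
  dotH y y * (dotH x x * dotH y y - dotH x y ^+ 2) by ring.
by rewrite pmulr_rge0// subr_ge0.
Qed.

End InnerProduct.

Section Frames.
Context {R : realType} {H X : completeNormedModType R}.
Variables (dotH : {dot H for idfun}) (iota : {linear X -> H}).
Hypothesis dotH_norm : induces_norm dotH.
Hypothesis iota_inj : injective iota.
Local Notation form x y := (dotH (iota x) (iota y)).

Let iota_eq0 x : iota x = 0 -> x = 0.
Proof. by move=> ix; apply: iota_inj; rewrite ix linear0. Qed.

(** Gram-Schmidt: a new vector is replaced by the normalized difference to its
    projection, or dropped if that difference is zero. *)
Lemma orthonormal_basis (W : set X) : findim_subspace W ->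
  exists d (e : 'I_d -> X), (forall i j, (form (e i) (e j)) = (i == j)%:R) /\
    W = [set x | exists c : 'I_d -> R, x = \sum_(j < d) c j *: e j].
Proof.
case=> n [b ->] {W}; elim: n b => [|n IHn] b.
  by exists 0%N, b; split => // -[].
have [d [e [e_on spanE]]] := IHn (fun j => b (lift ord_max j)).
have spanP (x : X) :
    (exists c : 'I_n -> R, x = \sum_(j < n) c j *: b (lift ord_max j)) <->
    (exists c : 'I_d -> R, x = \sum_(j < d) c j *: e j).
  by move/seteqP: spanE => [s1 s2]; split => [/s1|/s2].
have big_lift m (F : 'I_m.+1 -> X) :
    \sum_(j < m.+1) F j = F ord_max + \sum_(j < m) F (lift ord_max j).
  rewrite big_ord_recr addrC /=; congr (_ + _); apply: eq_bigr => i _.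
  by congr F; apply: val_inj; rewrite /= /bump leqNgt ltn_ord.
pose bm := b ord_max.
pose y := bm - \sum_j (form bm (e j)) *: e j.
have ye j : (form y (e j)) = 0.
  rewrite linearB linear_sum dotBl dot_suml (bigD1 j)//= big1 ?addr0 => [|i ij].
    by rewrite linearZ dotZl e_on eqxx mulr1 subrr.
  by rewrite linearZ dotZl e_on (negbTE ij) mulr0.
have bmE : bm = y + \sum_j (form bm (e j)) *: e j by rewrite subrK.
have [y0|yN0] := eqVneq y 0.
  exists d, e; split => //; apply/seteqP; split => x /= [c ->].
    rewrite big_lift -/bm bmE y0 add0r.
    have /spanP[c' ->] : exists c' : 'I_n -> R,
        \sum_(j < n) c (lift ord_max j) *: b (lift ord_max j) =
        \sum_(j < n) c' j *: b (lift ord_max j) by exists (fun j => c (lift ord_max j)).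
    exists (fun j => c ord_max * (form bm (e j)) + c' j).
    by rewrite scaler_sumr -big_split /=; apply: eq_bigr => j _;
      rewrite scalerDl scalerA.
  have /spanP[c' ->] : exists c' : 'I_d -> R,
      \sum_(j < d) c j *: e j = \sum_(j < d) c' j *: e j.
    by exists c.
  exists (fun j => if unlift ord_max j is Some i then c' i else 0).
  rewrite big_lift unlift_none scale0r add0r.
  by apply: eq_bigr => j _; rewrite liftK.
have yy_gt0 : 0 < (form y y).
  by apply: neq0_dnorm_gt0; apply: contra yN0 => /eqP/iota_eq0 ->.
pose ny := Num.sqrt (form y y).
have ny_gt0 : 0 < ny by rewrite sqrtr_gt0.
pose e' (j : 'I_d.+1) := if unlift ord_max j is Some i then e i else ny^-1 *: y.
have e'max : e' ord_max = ny^-1 *: y by rewrite /e' unlift_none.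
have e'lift j : e' (lift ord_max j) = e j by rewrite /e' liftK.
exists d.+1, e'; split.
  move=> i j; case: (unliftP ord_max i) => [i' ->|->];
    case: (unliftP ord_max j) => [j' ->|->].
  - by rewrite !e'lift e_on (inj_eq lift_inj).
  - rewrite e'lift e'max linearZ /= dotC dotZl ye mulr0.
    by rewrite eq_sym (negbTE (neq_lift _ _)).
  - rewrite e'lift e'max linearZ /= dotZl ye mulr0.
    by rewrite (negbTE (neq_lift _ _)).
  - have nyE : form y y = ny ^+ 2 by rewrite sqr_sqrtr// ltW.
    rewrite e'max linearZ /= dotZl dotZr nyE eqxx /=.
    by field; rewrite gt_eqF.
apply/seteqP; split => x /= [c ->].
  rewrite big_lift -/bm bmE.
  have /spanP[c' ->] : exists c' : 'I_n -> R,
      \sum_(j < n) c (lift ord_max j) *: b (lift ord_max j) =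
      \sum_(j < n) c' j *: b (lift ord_max j) by exists (fun j => c (lift ord_max j)).
  exists (fun j => if unlift ord_max j is Some i then c ord_max * (form bm (e i)) + c' i
                   else c ord_max * ny).
  rewrite big_lift unlift_none e'max scalerDr scalerA mulfK ?gt_eqF// -addrA.
  congr (_ + _); rewrite scaler_sumr -big_split /=; apply: eq_bigr => j _.
  by rewrite liftK e'lift scalerDl scalerA.
rewrite big_lift e'max scalerA.
under eq_bigr do rewrite e'lift.
have yE : y = bm - \sum_j (form bm (e j)) *: e j by [].
set t := c ord_max / ny.
have -> : t *: y + \sum_(j < d) c (lift ord_max j) *: e j =
    t *: bm + \sum_(j < d) (c (lift ord_max j) - t * (form bm (e j))) *: e j.
  rewrite yE scalerBr -addrA; congr (_ + _); rewrite scaler_sumr -sumrN -big_split /=.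
  by apply: eq_bigr => j _; rewrite scalerBl scalerA addrC.
have /spanP[c' ->] : exists c' : 'I_d -> R,
    \sum_(j < d) (c (lift ord_max j) - t * (form bm (e j))) *: e j =
      \sum_(j < d) c' j *: e j.
  by eexists.
exists (fun j => if unlift ord_max j is Some i then c' i else t).
by rewrite big_lift unlift_none; congr (_ + _); apply: eq_bigr => j _; rewrite liftK.
Qed.

(** Unlike an orthonormal basis, a Parseval frame may contain zero vectors and
    linear dependencies; the splitting into real and imaginary parts produces
    both. *)
Definition parseval_frame (W : set X) (J : finType) (phi : J -> X) : Prop :=
  (forall c : J -> R, W (\sum_j c j *: phi j)) /\
  forall x, W x -> \sum_j (form x (phi j)) ^+ 2 = (form x x).

Variable A : {linear X -> (X -> R^o)}.
Hypothesis A_lin : forall v, linear (A v).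
Hypothesis A_sym : forall v w, A v w = A w v.

Lemma eigen_frame (W : set X) : findim_subspace W ->
  exists (J : finType) (phi : J -> X) (lam : J -> R),
    parseval_frame W phi /\
    forall j v, W v -> A v (phi j) = lam j * (form v (phi j)).
Proof.
move=> /orthonormal_basis[d [e [e_on ->]]].
have AD v x y c : A v (c *: x + y) = c * A v x + A v y by exact: A_lin.
have A0 v : A v 0 = 0 by have := AD v 0 0 (-1); rewrite scaler0 addr0; lra.
have A_sum v (F : 'I_d -> R) : A v (\sum_i F i *: e i) = \sum_i F i * A v (e i).
  elim/big_rec2: _ => [|i x y _ <-]; first exact: A0.
  by rewrite AD.
pose S : 'M[R]_d := \matrix_(i, j) A (e i) (e j).
have [|q [lam [qS qP]]] := @symmetric_parseval_frame R d S.
  by apply/matrixP => i j; rewrite !mxE A_sym.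
pose phi j := \sum_i q j 0 i *: e i.
have dot_e (c : 'I_d -> R) i : (form (\sum_l c l *: e l) (e i)) = c i.
  rewrite linear_sum dot_suml (bigD1 i)//= big1 ?addr0 => [|l li].
    by rewrite linearZ dotZl e_on eqxx mulr1.
  by rewrite linearZ dotZl e_on (negbTE li) mulr0.
have dot_phi (c : 'I_d -> R) j :
    (form (\sum_l c l *: e l) (phi j)) = \sum_i q j 0 i * c i.
  rewrite [iota (phi j)]linear_sum dot_sumr; apply: eq_bigr => i _.
  by rewrite linearZ /= dotZr dot_e.
exists ('I_d + 'I_d)%type, phi, lam; split.
  split.
    move=> c; exists (fun i => \sum_j c j * q j 0 i).
    under eq_bigr do rewrite /phi scaler_sumr.
    rewrite exchange_big /=; apply: eq_bigr => i _.
    by rewrite scaler_suml; apply: eq_bigr => j _; rewrite scalerA.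
  move=> x [c ->]; have := qP (\col_i c i).
  under eq_bigr do rewrite mxE.
  have -> : (form (\sum_j c j *: e j) (\sum_j c j *: e j)) = \sum_i c i ^+ 2.
    rewrite [X in dotH _ X]linear_sum dot_sumr; apply: eq_bigr => i _.
    by rewrite linearZ /= dotZr dot_e expr2.
  move=> qPc; transitivity (\sum_i (\col_i0 c i0) i 0 ^+ 2).
    rewrite -qPc; apply: eq_bigr => j _; rewrite dot_phi; congr (_ ^+ 2).
    by apply: eq_bigr => i _; rewrite mxE.
  by apply: eq_bigr => i _; rewrite mxE.
move=> j v [c ->].
rewrite dot_phi A_sym A_sum mulr_sumr; apply: eq_bigr => i _.
rewrite A_sym /phi A_sum.
have := congr1 (fun M : 'rV[R]_d => M 0 i) (qS j); rewrite !mxE => qSi.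
rewrite mulrA -qSi mulrC; congr (_ * _); apply: eq_bigr => l _.
by rewrite mxE A_sym.
Qed.

End Frames.

(** * Lower integrals and the Cauchy-Schwarz inequality *)

Section LowerIntegral.
Context {R : realType}.
Local Notation mu := (@lebesgue_measure R).
Import HBNNSimple.
Local Notation sfun := {nnsfun (g_sigma_algebraType R.-ocitv.-measurable) >-> R}.

Lemma nnsfun_le_integral (D : set R) (g : R -> \bar R) (h : sfun) :
  (forall x, D x -> 0 <= g x)%E -> (forall x, (h x)%:E <= (g \_ D) x)%E ->
  (sintegral mu h <= \int[mu]_(x in D) g x)%E.
Proof.
by move=> g_ge0 hg; rewrite ge0_integralE//; apply: ereal_sup_ubound; exists h.
Qed.

(** This and the previous lemma are the two sides of the definition of the
    integral of a nonnegative function as a supremum over simple functions. *)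
Lemma integral_le_sintegral (D : set R) (g : R -> \bar R) (M : \bar R) :
  (forall x, D x -> 0 <= g x)%E ->
  (forall h : sfun, (forall x, (h x)%:E <= (g \_ D) x)%E ->
     (sintegral mu h <= M)%E) ->
  (\int[mu]_(x in D) g x <= M)%E.
Proof.
by move=> g_ge0 hM; rewrite ge0_integralE//; apply: ge_ereal_sup => _ [h /= hg <-];
  exact: hM.
Qed.

Lemma le_integral_lower (A B : set R) (g1 g2 : R -> \bar R) :
  (forall x, A x -> 0 <= g1 x)%E -> (forall x, B x -> 0 <= g2 x)%E ->
  (forall x, (g1 \_ A) x <= (g2 \_ B) x)%E ->
  (\int[mu]_(x in A) g1 x <= \int[mu]_(x in B) g2 x)%E.
Proof.
move=> g1_ge0 g2_ge0 g12; apply: integral_le_sintegral => // h hg.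
by apply: nnsfun_le_integral => // x; apply: le_trans (hg x) (g12 x).
Qed.

Lemma le_integral_subset (A B : set R) (g : R -> \bar R) :
  A `<=` B -> (forall x, 0 <= g x)%E ->
  (\int[mu]_(x in A) g x <= \int[mu]_(x in B) g x)%E.
Proof.
move=> AB g_ge0; apply: le_integral_lower => // x.
rewrite !patchE; case: ifPn => [/set_mem /AB Bx|_]; first by rewrite mem_set.
by case: ifP.
Qed.

(** Simple functions below [g] on [A] and on [B] add up to one below [g] on [C];
    so the suprema are superadditive for every nonnegative [g]. *)
Lemma integral_superadditive (A B C : set R) (g : R -> \bar R) :
  A `<=` C -> B `<=` C -> A `&` B = set0 -> (forall x, 0 <= g x)%E ->
  (\int[mu]_(x in A) g x + \int[mu]_(x in B) g x <= \int[mu]_(x in C) g x)%E.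
Proof.
move=> AC BC AB g_ge0.
have [->|] := eqVneq (\int[mu]_(x in C) g x)%E +oo%E; first by rewrite leey.
rewrite -ltey -ge0_fin_numE ?integral_ge0// => finC.
have finD D : D `<=` C -> (\int[mu]_(x in D) g x)%E \is a fin_num.
  move=> DC; rewrite ge0_fin_numE ?integral_ge0//;
    apply: le_lt_trans (le_integral_subset DC g_ge0) _.
  by rewrite -ge0_fin_numE ?integral_ge0.
rewrite -leeBrDr ?finD//; apply: integral_le_sintegral => // h1 h1A.
have fin1 : sintegral mu h1 \is a fin_num.
  rewrite ge0_fin_numE ?sintegral_ge0//;
    apply: (@le_lt_trans _ _ (\int[mu]_(x in A) g x)%E).
    exact: nnsfun_le_integral.
  by rewrite -ge0_fin_numE ?integral_ge0// finD.
rewrite leeBrDr ?finD// addeC -leeBrDr//; apply: integral_le_sintegral => // h2 h2B.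
rewrite leeBrDr// -sintegralD//; apply: nnsfun_le_integral => // x /=.
have := h1A x; have := h2B x; rewrite !patchE.
case: ifPn => [/set_mem Bx|_]; case: ifPn => [/set_mem Ax|_].
- by have : (A `&` B) x by []; rewrite AB.
- rewrite ifT ?mem_set//; last exact: BC.
  by move=> h2g h1g; rewrite EFinD -[leRHS]adde0 leeD.
- rewrite ifT ?mem_set//; last exact: AC.
  by move=> h2g h1g; rewrite EFinD -[leRHS]add0e leeD.
- move=> h2g h1g; rewrite EFinD (le_trans (leeD h2g h1g))// adde0; case: ifP => //.
Qed.

(** Turns Young's inequality with every weight into a Cauchy-Schwarz inequality;
    the optimal weight is [x / N]. *)
Lemma le_sqrt_of_young (x N J : R) : 0 <= N -> 0 <= J ->
  (forall th, 0 < th -> 2 * x <= th * N + J / th) -> x <= Num.sqrt (N * J).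
Proof.
move=> N_ge0 J_ge0 young.
have [x_le0|x_gt0] := leP x 0; first by rewrite (le_trans x_le0)// sqrtr_ge0.
rewrite -(ger0_norm (ltW x_gt0)) -sqrtr_sqr ler_wsqrtr//.
have [N0|N_neq0] := eqVneq N 0.
  have J1_gt0 : 0 < J + 1 by rewrite ltr_wpDl.
  have := young ((J + 1) / x) (divr_gt0 J1_gt0 x_gt0); rewrite N0 mulr0 add0r.
  have -> : J / ((J + 1) / x) = x - x / (J + 1) by field; rewrite !gt_eqF.
  by have := divr_gt0 x_gt0 J1_gt0; lra.
have N_gt0 : 0 < N by rewrite lt_def N_neq0.
have := young (x / N) (divr_gt0 x_gt0 N_gt0).
have -> : x / N * N + J / (x / N) = x + N * J / x by field; rewrite !gt_eqF.
move=> le2; have : x <= N * J / x by lra.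
by rewrite ler_pdivlMr// -expr2.
Qed.

(** A simple function [h] below [u^+] satisfies
    [2 h <= th g^2 + q / th]. So the measurable function
    [w = max(0, (2 h - q / th) / th)] is below [g^2], and the integral of [w] is
    at most that of [g^2] by the definition of the latter; all remaining
    integrals are those of measurable functions. *)
Lemma Rintegral_cauchy_schwarz (a b : R) (u g v : R -> R) (q : {poly R}) (N : R) :
  a < b ->
  (forall x, a < x < b -> u x <= `|g x| * `|v x|) ->
  (forall x, a < x < b -> v x ^+ 2 <= q.[x]) ->
  (\int[mu]_(x in `]a, b[) (g x ^+ 2)%:E <= N%:E)%E ->
  (\int[mu]_(x in `]a, b]) u x)%R <= Num.sqrt (N * pint a b q).
Proof.
move=> ltab u_le v_le gN.
have N_ge0 : 0 <= N.
  by rewrite -lee_fin; apply: le_trans gN; apply: integral_ge0 => x _;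
    rewrite lee_fin sqr_ge0.
have q_ge0 x : a < x < b -> 0 <= q.[x].
  by move=> /v_le; apply: le_trans; exact: sqr_ge0.
have J_ge0 := pint_ge0 ltab q_ge0; set J := pint a b q in J_ge0 *.
apply: le_sqrt_of_young => // th th_gt0.
set B := (th * N + J / th) / 2.
have B_ge0 : 0 <= B by rewrite divr_ge0// addr_ge0 ?divr_ge0 ?mulr_ge0 ?(ltW th_gt0).
have up_le : (\int[mu]_(x in `]a, b]) (fun x => (u x)%:E)^\+ x <= B%:E)%E.
  apply: integral_le_sintegral => [x _|h h_le]; first exact: funepos_ge0.
  have mh D : measurable_fun D h by apply: measurable_funTS.
  have hE : h = (fun x => h x) \_ `]a, b] :> (R -> R).
    apply/funext => x; rewrite patchE; case: ifPn => // xD.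
    have := h_le x; rewrite patchE (negbTE xD) lee_fin => hx.
    by apply/eqP; rewrite eq_le hx fun_ge0.
  rewrite -integralT_nnsfun.
  have -> : (\int[mu]_x (h x)%:E = \int[mu]_(x in `]a, b[) (h x)%:E)%E.
    rewrite [RHS]integral_itv_bndo_bndc; last by apply/measurable_EFinP;
      exact: (mh `]a, b[%classic).
    rewrite [RHS]integral_mkcond; apply: eq_integral => x _.
    have := congr1 (fun F : R -> R => F x) hE; rewrite !patchE.
    by case: ifPn => // _ ->.
  pose w x := Num.max 0 ((2 * h x - q.[x] / th) / th).
  have mq D : measurable_fun D (horner q) by exact: measurable_poly.
  have mw D : measurable_fun D w.
    apply: measurable_maxr => //; apply: measurable_funM => //.
    apply: measurable_funB; first exact: measurable_funM.
    by apply: measurable_funM; [exact: measurable_poly|exact: measurable_cst].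
  have w_le : (\int[mu]_(x in `]a, b[) (w x)%:E <= N%:E)%E.
    apply: le_trans gN; apply: le_integral_lower => [x _|x _|x].
    - by rewrite lee_fin le_max lexx.
    - by rewrite lee_fin sqr_ge0.
    - rewrite !patchE; case: ifPn => // /set_mem xab.
      have xab' : a < x < b by move: xab; rewrite /= in_itv.
      rewrite lee_fin ge_max sqr_ge0 /= ler_pdivrMr// lerBlDr.
      have := h_le x; rewrite patchE ifT; last first.
        by rewrite inE /= in_itv /=; case/andP: xab' => -> /ltW ->.
      rewrite funeposE -EFin_max lee_fin => hx.
      have : h x <= `|g x| * `|v x|.
        by apply: le_trans hx _; rewrite ge_max u_le//= mulr_ge0.
      have := v_le x xab'; rewrite -(real_normK (num_real (v x)))
        -(real_normK (num_real (g x))).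
      move=> v2 hgv.
      have sq : 0 <= (th * `|g x| - `|v x|) ^+ 2 by exact: sqr_ge0.
      rewrite -(ler_pM2r th_gt0) [leRHS]mulrDl divfK ?gt_eqF//.
      have : 2 * h x * th <= 2 * (`|g x| * `|v x|) * th.
        by rewrite ler_pM2r// ler_pM2l.
      move: sq v2; nra.
  have -> : B = (2^-1 * (th * N + J / th)) by rewrite /B mulrC.
  apply: (@le_trans _ _ (\int[mu]_(x in `]a, b[) ((2^-1 * th)%:E * (w x)%:E +
    ((2^-1 / th) *: q).[x]%:E))%E).
    apply: ge0_le_integral => //.
    - by move=> x _; rewrite lee_fin.
    - exact/measurable_EFinP.
    - apply: emeasurable_funD; last first.
        by apply/measurable_EFinP; exact: measurable_poly.
      by apply: emeasurable_funM => //; apply/measurable_EFinP; exact: mw.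
    - move=> x _; rewrite -EFinM -EFinD lee_fin hornerZ.
      have : (2 * h x - q.[x] / th) / th <= w x by rewrite le_max lexx orbT.
      rewrite ler_pdivrMr// => le_w.
      have -> : 2^-1 / th * q.[x] = 2^-1 * (q.[x] / th) by rewrite mulrAC mulrA.
      lra.
  have wq_ge0 x : `]a, b[%classic x -> (0 <= (((2^-1 / th) *: q).[x])%:E)%E.
    rewrite /= in_itv /= => xab; rewrite lee_fin hornerZ mulr_ge0 ?q_ge0//.
    by rewrite divr_ge0// ltW.
  have c_ge0 : 0 <= 2^-1 * th by rewrite mulr_ge0// ltW.
  have w_ge0 x : 0 <= w x by rewrite le_max lexx.
  have mcw : measurable_fun `]a, b[ (fun x => (2^-1 * th * w x)%:E).
    by apply/measurable_EFinP; apply: measurable_funM => //; exact: mw.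
  have mq' : measurable_fun `]a, b[ (fun x => ((2^-1 / th) *: q).[x]%:E).
    by apply/measurable_EFinP; exact: measurable_poly.
  rewrite ge0_integralD//=; last by move=> x _; rewrite -EFinM lee_fin mulr_ge0.
  have mwE : measurable_fun `]a, b[ (fun x => (w x)%:E).
    by apply/measurable_EFinP; exact: mw.
  rewrite integral_poly// ge0_integralZl//; last by move=> x _; rewrite lee_fin.
  have -> : 2^-1 * (th * N + J / th) = 2^-1 * th * N + 2^-1 / th * J by ring.
  rewrite pintZ -/J EFinD; apply: leeD => //.
  by rewrite [leRHS]EFinM; apply: lee_wpmul2l.
suff : (\int[mu]_(x in `]a, b]) u x)%R <= B by rewrite /B; lra.
rewrite /Rintegral integralE.
have fin_p : (\int[mu]_(x in `]a, b]) (fun x => (u x)%:E)^\+ x)%E \is a fin_num.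
  rewrite ge0_fin_numE; last by apply: integral_ge0 => x _; exact: funepos_ge0.
  exact: le_lt_trans up_le (ltry _).
have n_ge0 : (0 <= \int[mu]_(x in `]a, b]) (fun x => (u x)%:E)^\- x)%E.
  by apply: integral_ge0 => x _; exact: funeneg_ge0.
move: up_le n_ge0; rewrite -(fineK fin_p); move: (fine _) => y.
case: (\int[mu]_(x in `]a, b]) (fun x => (u x)%:E)^\- x)%E => [z| |] //=.
by rewrite !lee_fin; lra.
Qed.

Lemma L2_normP (V : completeNormedModType R) (D : set R) (f : R -> V) :
  (L2_norm D f < +oo)%E -> exists2 L : R, 0 <= L &
    L2_norm D f = L%:E /\ (\int[mu]_(x in D) (`|f x| ^+ 2)%:E)%E = (L ^+ 2)%:E.
Proof.
move=> finL; have finL' : L2_norm D f \is a fin_num.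
  by rewrite ge0_fin_numE// Lnorm_ge0.
exists (fine (L2_norm D f)); first by rewrite fine_ge0// Lnorm_ge0.
rewrite fineK//; split => //.
transitivity (L2_norm D f `^ 2)%E.
  rewrite /L2_norm powR_Lnorm ?pnatr_eq0// [LHS]integral_mkcond;
    apply: eq_integral => x _ /=.
  rewrite !patchE; case: ifPn => _; first by rewrite normr_id powR_mulrn.
  by rewrite normr0 powR0 ?pnatr_eq0.
by rewrite -(fineK finL') poweR_EFin powR_mulrn// fine_ge0// Lnorm_ge0.
Qed.

End LowerIntegral.

(** * Polynomials with vector coefficients *)

Section VectorPolynomials.
Context {R : realType} {X : completeNormedModType R}.

Lemma is_derive_polyZ (p : {poly R}) (x : X) (s : R) :
  is_derive s (1 : R) (fun s : R => p.[s] *: x) (p^`().[s] *: x).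
Proof.
have [dp p's] := is_derive_poly p s.
pose quot := fun h : R =>
  h^-1 *: (((fun s : R => p.[s] *: x) \o shift s) (h *: (1 : R)) - p.[s] *: x).
have dc : quot @ 0^' --> p^`().[s] *: x.
  rewrite -p's.
  have -> : quot =
      (fun h : R => (h^-1 *: ((horner p \o shift s) (h *: (1 : R)) - p.[s])) *: x).
    by apply/funext => h; rewrite /quot /= -scalerBl scalerA.
  exact: cvgZr_tmp dp.
apply: DeriveDef; first by apply/cvg_ex; exists (p^`().[s] *: x).
by apply: cvg_lim dc; exact: norm_hausdorff.
Qed.

Definition vpoly n (p : 'I_n -> {poly R}) (c : 'I_n -> X) (s : R) : X :=
  \sum_(k < n) (p k).[s] *: c k.

Lemma is_derive_vpoly n (p : 'I_n -> {poly R}) (c : 'I_n -> X) (s : R) :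
  is_derive s (1 : R) (vpoly p c) (vpoly (fun k => (p k)^`()) c s).
Proof.
have -> : vpoly p c = \sum_(k < n) (fun s => (p k).[s] *: c k).
  by apply/funext => x; rewrite fct_sumE.
by apply: is_derive_sum => k; exact: is_derive_polyZ.
Qed.

Lemma continuous_vpoly n (p : 'I_n -> {poly R}) (c : 'I_n -> X) :
  continuous (vpoly p c).
Proof.
move=> s; apply: differentiable_continuous; apply/derivable1_diffP.
by case: (is_derive_vpoly p c s).
Qed.

Variables (a b : R) (n : nat) (p : 'I_n -> {poly R}) (c : 'I_n -> X) (U : R -> X).
Hypothesis ltab : a < b.
Hypothesis UE : forall s, a < s <= b -> U s = vpoly p c s.

(** Only the values of [U] on ]a, b] are known, so its one-sided limits and its
    derivative are transferred from the polynomial by locality. *)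
Lemma lim_vpoly_right : lim (U @ a^'+) = vpoly p c a.
Proof.
apply: cvg_lim; first exact: norm_hausdorff.
apply: cvg_trans (cvg_at_right_filter (@continuous_vpoly _ p c a)).
apply: near_eq_cvg; near=> s; apply/esym/UE.
by apply/andP; split; near: s; [exact: nbhs_right_gt|exact: nbhs_right_le].
Unshelve. all: by end_near. Qed.

Lemma lim_vpoly_left : lim (U @ b^'-) = vpoly p c b.
Proof.
apply: cvg_lim; first exact: norm_hausdorff.
apply: cvg_trans (cvg_at_left_filter (@continuous_vpoly _ p c b)).
apply: near_eq_cvg; near=> s; apply/esym/UE.
apply/andP; split; first by near: s; exact: nbhs_left_gt.
by apply: ltW; near: s; exact: nbhs_left_lt.
Unshelve. all: by end_near. Qed.

Lemma derive1_vpoly s : a < s < b -> derive1 U s = vpoly (fun k => (p k)^`()) c s.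
Proof.
move=> /andP[as_ sb]; rewrite derive1E.
have [_ <-] := is_derive_vpoly p c s.
apply: near_eq_derive.
near=> x; apply: UE; apply/andP; split.
  by near: x; exact: lt_nbhsr.
by apply: ltW; near: x; exact: lt_nbhsl.
Unshelve. all: by end_near. Qed.

End VectorPolynomials.

Section Subspaces.
Context {R : realType} {X : completeNormedModType R}.

Lemma findim_sum (W : set X) : findim_subspace W ->
  forall n (x : 'I_n -> R) (c : 'I_n -> X), (forall k, W (c k)) ->
  W (\sum_(k < n) x k *: c k).
Proof.
move=> [d [b ->]] n x c Wc.
have /choice[m mE] : forall k, exists m : 'I_d -> R,
    c k = \sum_(j < d) m j *: b j := Wc.
exists (fun j => \sum_k x k * m k j).
under eq_bigr do rewrite mE scaler_sumr.
rewrite exchange_big /=; apply: eq_bigr => j _.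
by rewrite scaler_suml; apply: eq_bigr => k _; rewrite scalerA.
Qed.

End Subspaces.

(** * Stability of one time step *)

Section FiniteSums.
Context {R : realType} {J : finType}.

Lemma sum_cauchy_schwarz (x y : J -> R) :
  \sum_j x j * y j <= Num.sqrt ((\sum_j x j ^+ 2) * (\sum_j y j ^+ 2)).
Proof.
apply: le_sqrt_of_young => [||th th_gt0]; [by apply: sumr_ge0 => j _;
  exact: sqr_ge0..|].
rewrite !mulr_sumr mulr_suml -big_split /=; apply: ler_sum => j _.
rewrite -(ler_pM2r th_gt0).
have -> : (th * x j ^+ 2 + y j ^+ 2 / th) * th = (th * x j) ^+ 2 + y j ^+ 2.
  by field; rewrite gt_eqF.
by have := sqr_ge0 (th * x j - y j); rewrite sqrrB; lra.
Qed.

(** Minkowski's inequality for finite sequences, with upper bounds in place of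
    the two norms. *)
Lemma sum_minkowski (x y : J -> R) (G B : R) : 0 <= G -> 0 <= B ->
  \sum_j x j ^+ 2 <= G ^+ 2 -> \sum_j y j ^+ 2 <= B ^+ 2 ->
  \sum_j (x j + y j) ^+ 2 <= (G + B) ^+ 2.
Proof.
move=> G_ge0 B_ge0 xG yB.
have xy : \sum_j x j * y j <= G * B.
  apply: le_trans (sum_cauchy_schwarz x y) _.
  rewrite -(ger0_norm (mulr_ge0 G_ge0 B_ge0)) -sqrtr_sqr ler_wsqrtr// exprMn.
  by apply: ler_pM => //; apply: sumr_ge0 => j _; exact: sqr_ge0.
have -> : \sum_j (x j + y j) ^+ 2 =
    \sum_j x j ^+ 2 + 2 * (\sum_j x j * y j) + \sum_j y j ^+ 2.
  by rewrite mulr_sumr -!big_split /=; apply: eq_bigr => j _; ring.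
by rewrite sqrrD; lra.
Qed.

End FiniteSums.

Section Step.
Context {R : realType} {H X : completeNormedModType R}.
Variables (dotH : {dot H for idfun}) (iota : {linear X -> H}).
Hypothesis dotH_norm : induces_norm dotH.
Hypothesis iota_inj : injective iota.
Variable A : {linear X -> (X -> R^o)}.
Hypothesis A_lin : forall v, linear (A v).
Hypothesis A_sym : forall v w, A v w = A w v.
Hypothesis A_pos : forall v, v != 0 -> 0 < A v v.
Local Notation form x y := (dotH (iota x) (iota y)).
Local Notation mu := (@lebesgue_measure R).

Lemma form_suml (J : finType) (x : J -> R) (c : J -> X) z :
  dotH (iota (\sum_j x j *: c j)) z = \sum_j x j * dotH (iota (c j)) z.
Proof.
by rewrite linear_sum dot_suml; apply: eq_bigr => j _; rewrite linearZ /= dotZl.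
Qed.

Lemma form_sumr (J : finType) (x : J -> R) (c : J -> X) z :
  dotH z (iota (\sum_j x j *: c j)) = \sum_j x j * dotH z (iota (c j)).
Proof. by rewrite dotC form_suml; apply: eq_bigr => j _; rewrite dotC. Qed.

Lemma form_gt0 x : x != 0 -> 0 < form x x.
Proof.
move=> xN0; apply: neq0_dnorm_gt0; apply: contra xN0 => /eqP ix0.
by apply/eqP; apply: iota_inj; rewrite ix0 linear0.
Qed.

Section Frame.
Variables (W : set X) (J : finType) (phi : J -> X) (lam : J -> R).
Hypothesis W_findim : findim_subspace W.
Hypothesis phi_frame : parseval_frame dotH iota W phi.
Hypothesis phi_eig : forall j v, W v -> A v (phi j) = lam j * form v (phi j).

Lemma frame_mem j : W (phi j).
Proof.
have := phi_frame.1 (fun i => (i == j)%:R).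
rewrite (bigD1 j)//= eqxx scale1r big1 ?addr0// => i.
by move=> /negbTE->; rewrite scale0r.
Qed.

(** Synthesis with a Parseval frame is a contraction, being adjoint to the
    isometry [x |-> (form x (phi j))_j]. *)
Lemma frame_norm_le (x : J -> R) :
  `|iota (\sum_j x j *: phi j)| ^+ 2 <= \sum_j x j ^+ 2.
Proof.
set v := \sum_j _; have Wv : W v by exact: phi_frame.1.
have vE : form v v = \sum_j x j * form v (phi j) by rewrite {2}/v form_sumr.
have Q : 2 * form v v <= \sum_j x j ^+ 2 + form v v.
  rewrite [in leLHS]vE -(phi_frame.2 _ Wv) -big_split mulr_sumr /=.
  by apply: ler_sum => j _; have := sqr_ge0 (x j - form v (phi j)); rewrite sqrrB; lra.
by rewrite (sqr_norm_dot dotH_norm); lra.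
Qed.

(** The left-hand side is the squared norm of the orthogonal projection of [y]
    on [W]. *)
Lemma frame_bessel (y : H) : \sum_j dotH y (iota (phi j)) ^+ 2 <= `|y| ^+ 2.
Proof.
set S := \sum_j _; have S_ge0 : 0 <= S by apply: sumr_ge0 => j _; exact: sqr_ge0.
pose v := \sum_j dotH y (iota (phi j)) *: phi j.
have yv : dotH y (iota v) = S by rewrite form_sumr; apply: eq_bigr => j _;
  rewrite expr2.
have v2 : `|iota v| ^+ 2 <= S by exact: frame_norm_le.
have : S <= `|y| * `|iota v| by rewrite -yv (le_trans (ler_norm _)) ?dot_le_norm.
have y_ge0 := normr_ge0 y; have v_ge0 := normr_ge0 (iota v).
move: (`|y|) (`|iota v|) y_ge0 v_ge0 v2 => Y V Y_ge0 V_ge0 v2 SYV.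
have := sqr_ge0 (Y - V); rewrite sqrrB; lra.
Qed.

Lemma eigenvalue_gt0 j : phi j != 0 -> 0 < lam j.
Proof.
move=> phiN0; have := A_pos phiN0; rewrite phi_eig; last exact: frame_mem.
by rewrite pmulr_lgt0// form_gt0.
Qed.

(** A supremum bounds its members only if the set is bounded above. Here the set
    is finite: an eigenvector [u] has a nonzero frame coefficient
    [form u (phi i)], and symmetry of [A] forces its eigenvalue to be [lam i]. *)
Lemma C_scalar_le_C_max r (a b : R) j : phi j != 0 ->
  C_scalar (lam j) r a b <= C_max dotH iota A W r a b.
Proof.
move=> phiN0; have Wphi := frame_mem.
pose P u := [set w | W w /\ forall v, W v -> form w v = A u v].
have dE u : discrete_op dotH iota A W u = xget 0 (P u) by [].
apply: ub_le_sup; last first.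
  exists (lam j) => //; exists (phi j); split=> //; first exact/eqP.
  rewrite dE; have Plam : P (phi j) (lam j *: phi j).
    split.
      have := findim_sum W_findim (fun _ : 'I_1 => lam j) (fun _ => Wphi j).
      by rewrite big_ord1.
    by move=> v Wv; rewrite linearZ /= dotZl A_sym phi_eig// dotC.
  have : P (phi j) (xget 0 (P (phi j))) by apply: xgetPex; exists (lam j *: phi j).
  move: (xget _ _) => w Pw; apply/eqP; rewrite -subr_eq0; apply: contraT => dN0.
  have := form_gt0 dN0; set d := w - _.
  have -> : form d d = form w d - form (lam j *: phi j) d.
    by rewrite {1}/d linearB dotBl.
  have dE' z : form z d = form z w - form z (lam j *: phi j).
    by rewrite /d linearB !(dotC dotH (iota z)) dotBl.
  rewrite !dE' (Pw.2 _ Pw.1) (Pw.2 _ Plam.1) (Plam.2 _ Pw.1) (Plam.2 _ Plam.1).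
  by rewrite subrr ltxx.
exists (`|C_scalar 0 r a b| + \sum_i `|C_scalar (lam i) r a b|) =>
  _ [l [u [Wu uN0 ul]] <-].
have C_ge0 i : 0 <= `|C_scalar (lam i) r a b| by exact: normr_ge0.
(* If [A u] had no representative in [W], [discrete_op] would be the default
   value 0 and the eigenvalue 0; the bound includes this case. *)
have [[w Pw]|noP] := pselect (exists w, P u w); last first.
  have l0 : l = 0.
    move: ul; rewrite dE xgetPN => [/esym/eqP|w Pw]; last by apply: noP; exists w.
    by rewrite scaler_eq0 => /orP[/eqP//|/eqP].
  by rewrite l0 (le_trans (ler_norm _))// lerDl sumr_ge0.
have {}Pw : P u (l *: u) by rewrite -ul dE; apply: xgetPex; exists w.
have [i ui] : exists i, form u (phi i) != 0.
  apply/existsP; apply: contraT => /existsPn noi.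
  have := form_gt0 (introN eqP uN0); rewrite -(phi_frame.2 _ Wu) big1 ?ltxx// => i _.
  by have /negPn/eqP-> := noi i; rewrite expr0n.
have -> : l = lam i.
  apply: (mulIf ui); rewrite -phi_eig// -(Pw.2 _ (Wphi i)).
  by rewrite linearZ /= dotZl.
rewrite (le_trans (ler_norm _))// (bigD1 i)//= addrCA lerDl addr_ge0// sumr_ge0//.
Qed.

End Frame.

(** The residuals themselves are the coefficients of the test function; then the
    left-hand side of the scheme is the sum of their squared norms. *)
Lemma dG_step_bound (W : set X) r (a b : R) (f : R -> H) (U : R -> X) (Um : X)
    (N gam : R) :
  findim_subspace W -> a < b -> dG_step dotH iota A W r a b f U Um ->
  (\int[mu]_(x in `]a, b[) (`|f x| ^+ 2)%:E <= N%:E)%E ->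
  0 <= gam -> C_max dotH iota A W r a b <= gam ->
  forall s, a < s <= b ->
  `|iota (U s)| <= `|iota Um| + gam * Num.sqrt ((b - a) * N).
Proof.
move=> Wfin ltab [[c [Wc Uc]] dG fN gam_ge0 C_le s sab].
have N_ge0 : 0 <= N.
  by rewrite -lee_fin; apply: le_trans fN; apply: integral_ge0 => x _;
    rewrite lee_fin sqr_ge0.
have k_gt0 : 0 < b - a by rewrite subr_gt0.
have [J [phi [lam [frame eig]]]] :=
  @eigen_frame R H X dotH iota iota_inj A A_lin A_sym W Wfin.
have Wphi := frame_mem frame.
pose Xk (k : 'I_r.+1) : {poly R} := 'X^k.
have UE x : a < x <= b -> U x = vpoly Xk c x.
  by move=> xab; rewrite Uc /= ?in_itv//; apply: eq_bigr => k _; rewrite hornerXn.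
have Wu x : W (vpoly Xk c x) by exact: findim_sum.
pose p j : {poly R} := \sum_(k < r.+1) form (c k) (phi j) *: 'X^k.
have pE j x : (p j).[x] = form (vpoly Xk c x) (phi j).
  rewrite form_suml horner_sum; apply: eq_bigr => k _.
  by rewrite hornerZ hornerXn mulrC.
have p'E j x : (p j)^`().[x] = form (vpoly (fun k => (Xk k)^`()) c x) (phi j).
  rewrite form_suml /p (big_morph _ (@derivD R) (deriv0 R)) horner_sum;
    apply: eq_bigr => k _.
  by rewrite derivZ hornerZ mulrC.
have sp j : (size (p j) <= r.+1)%N.
  apply: leq_trans (size_sum _ _ _) _; apply/bigmax_leqP => k _.
  by rewrite (leq_trans (size_scale_leq _ _))// size_polyXn.
pose g j := dotH (iota Um) (iota (phi j)).
have [chi chiL bound] := dG_scalar_bound ltab r.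
pose P j := dG_residual a chi (lam j) (g j) (p j).
have sP j : (size (P j) <= r.+1)%N by apply: (size_dG_residual _ _ chiL).
(* The test function sum_j P_j phi_j, written in powers of the time variable. *)
pose Vc (k : 'I_r.+1) := \sum_j (P j)`_k *: phi j.
pose V := vpoly Xk Vc.
have VE x : V x = \sum_j (P j).[x] *: phi j.
  rewrite /V /vpoly; under eq_bigr do rewrite scaler_sumr.
  rewrite exchange_big /=; apply: eq_bigr => j _.
  rewrite (horner_coef_wide _ (sP j)) scaler_suml; apply: eq_bigr => k _.
  by rewrite scalerA hornerXn mulrC.
have V_poly : poly_on `]a, b] r W V.
  exists Vc; split; first by move=> k; exact: frame.1.
  by move=> x _; apply: eq_bigr => k _; rewrite hornerXn.
pose q : {poly R} := \sum_j P j ^+ 2.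
have Iq : pint a b q = \sum_j pint a b (P j ^+ 2) by rewrite linear_sum.
have testE : (\int[mu]_(s in `]a, b]) dotH (f s) (iota (V s)))%R = pint a b q.
  rewrite -(dG V V_poly) (lim_vpoly_right ltab UE)
    (@lim_vpoly_right _ _ a b _ Xk Vc V ltab)//.
  rewrite (@Rintegral_eq_pint _ _ _ ltab _ (\sum_j (p j)^`() * P j))//; last first.
    move=> x xab; rewrite (derive1_vpoly UE)// VE form_sumr horner_sum.
    by apply: eq_bigr => j _; rewrite hornerM p'E mulrC.
  rewrite (@Rintegral_eq_pint _ _ _ ltab _ (\sum_j (lam j *: p j) * P j))//; last first.
    move=> x /andP[ax xb]; rewrite UE ?ax ?ltW// VE horner_sum.
    have AV (F : J -> R) :
        A (vpoly Xk c x) (\sum_j F j *: phi j) = \sum_j F j * A (vpoly Xk c x) (phi j).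
      elim/big_rec2: _ => [|j y z _ <-]; last exact: A_lin.
      have : A (vpoly Xk c x) (-1 *: 0 + 0) =
          -1 * A (vpoly Xk c x) 0 + A (vpoly Xk c x) 0.
        exact: A_lin.
      by rewrite scaler0 addr0; lra.
    by rewrite AV; apply: eq_bigr => j _; rewrite hornerM hornerZ pE eig// mulrC.
  rewrite -/(V a) VE form_sumr Iq !linear_sum /= -!big_split /=.
  apply: eq_bigr => j _; rewrite expr2 (pint_dG_residual _ _ _ chiL)//.
  have -> : dotH (iota (vpoly Xk c a - Um)) (iota (phi j)) = (p j).[a] - g j.
    by rewrite linearB dotBl pE.
  by rewrite mulrDl [pint _ _ (_ + _)]linearD /=; ring.
set Q := \sum_j pint a b (P j ^+ 2) in Iq.
have PJ_ge0 j : 0 <= pint a b (P j ^+ 2) by exact: pint_sqr_ge0.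
have Q_ge0 : 0 <= Q by exact: sumr_ge0.
have QN : Q <= N.
  have : Q <= Num.sqrt (N * Q).
    rewrite -{1}Iq -testE -Iq.
    apply: (@Rintegral_cauchy_schwarz _ _ _ _ (fun x => `|f x|)
      (fun x => `|iota (V x)|)) => //.
      by move=> x _; rewrite !normr_id (le_trans (ler_norm _)) ?dot_le_norm.
    move=> x _; rewrite VE (le_trans (frame_norm_le frame _))// horner_sum.
    by apply: ler_sum => j _; rewrite horner_exp.
  have [->//|QN0] := eqVneq Q 0.
  have Q_gt0 : 0 < Q by rewrite lt_def QN0.
  rewrite -ler_sqr ?nnegrE ?sqrtr_ge0// sqr_sqrtr ?mulr_ge0// expr2 ler_pM2r//.
have C_j j : phi j != 0 -> C_scalar (lam j) r a b <= gam.
  by move=> phiN0; apply: le_trans (C_scalar_le_C_max Wfin frame eig _ _ _ phiN0) C_le.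
have p_le j : `|(p j).[s]| <= `|g j| + gam * Num.sqrt ((b - a) * pint a b (P j ^+ 2)).
  (* A zero frame vector has no eigenvalue, but its coordinate vanishes. *)
  have [phi0|phiN0] := eqVneq (phi j) 0.
    by rewrite pE phi0 linear0 dotC dot0l normr0 addr_ge0// mulr_ge0// sqrtr_ge0.
  have lam_gt0 : 0 < lam j by exact: (eigenvalue_gt0 frame eig).
  apply: le_trans (bound (lam j) (g j) (p j) lam_gt0 (sp j) s sab) _.
  by rewrite lerD2l ler_wpM2r ?sqrtr_ge0// C_j.
rewrite -ler_sqr ?nnegrE ?addr_ge0 ?mulr_ge0 ?sqrtr_ge0//.
rewrite (sqr_norm_dot dotH_norm) UE// -(frame.2 _ (Wu s)).
under eq_bigr do rewrite -pE -[_ ^+ 2](real_normK (num_real _)).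
apply: le_trans (sum_minkowski (normr_ge0 (iota Um)) (mulr_ge0 gam_ge0 (sqrtr_ge0 _))
  (x := fun j => `|g j|) (y := fun j => gam * Num.sqrt ((b - a)
    * pint a b (P j ^+ 2))) _ _).
- by apply: ler_sum => j _; rewrite ler_sqr ?nnegrE ?addr_ge0 ?mulr_ge0 ?sqrtr_ge0.
- under eq_bigr do rewrite real_normK ?num_real//.
  exact: (frame_bessel frame (iota Um)).
- have -> : \sum_j (gam * Num.sqrt ((b - a) * pint a b (P j ^+ 2))) ^+ 2 =
      gam ^+ 2 * (b - a) * Q.
    rewrite mulr_sumr; apply: eq_bigr => j _.
    by rewrite exprMn sqr_sqrtr ?mulrA//; apply: mulr_ge0 => //; exact: ltW.
  rewrite exprMn sqr_sqrtr; last by apply: mulr_ge0 => //; exact: ltW.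
  rewrite mulrA ler_wpM2l//; apply: mulr_ge0; [exact: sqr_ge0|exact: ltW].
Qed.

End Step.

(** * Stability of the whole scheme *)

Section Norms.
Context {R : realType} {V : completeNormedModType R}.
Local Notation mu := (@lebesgue_measure R).

Lemma L2_norm_subset (A B : set R) (f : R -> V) : A `<=` B ->
  (L2_norm A f <= L2_norm B f)%E.
Proof.
move=> AB; rewrite /L2_norm unlock; apply: gt0_ler_poweR.
- by rewrite invr_ge0.
- by rewrite in_itv /= leey andbT; apply: integral_ge0 => x _; rewrite lee_fin;
    exact: powR_ge0.
- by rewrite in_itv /= leey andbT; apply: integral_ge0 => x _; rewrite lee_fin;
    exact: powR_ge0.
apply: le_integral_lower => [x _|x _|x]; [exact: poweR_ge0..|].
rewrite !patch_setT /=; rewrite !patchE.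
case: ifPn => [/set_mem /AB Bx|_]; first by rewrite mem_set.
rewrite normr0 lee_fin powR0 ?pnatr_eq0//; exact: powR_ge0.
Qed.

Lemma sqrt_mul_add (x y e n : R) : 0 <= x -> 0 <= y -> 0 <= e -> 0 <= n ->
  Num.sqrt (x * e) + Num.sqrt (y * n) <= Num.sqrt ((x + y) * (e + n)).
Proof.
move=> x_ge0 y_ge0 e_ge0 n_ge0.
have := sum_cauchy_schwarz (fun i : bool => Num.sqrt (if i then x else y))
  (fun i : bool => Num.sqrt (if i then e else n)).
by rewrite !big_bool /= !sqr_sqrtr// (sqrtrM e x_ge0) (sqrtrM n y_ge0).
Qed.

End Norms.

Section Stability.
Context {R : realType} {H X : completeNormedModType R}.
Variables (dotH : {dot H for idfun}) (iota : {linear X -> H}).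
Hypothesis dotH_norm : induces_norm dotH.
Hypothesis iota_inj : injective iota.
Variable A : {linear X -> (X -> R^o)}.
Hypothesis A_lin : forall v, linear (A v).
Hypothesis A_sym : forall v w, A v w = A w v.
Hypothesis A_pos : forall v, v != 0 -> 0 < A v v.
Local Notation mu := (@lebesgue_measure R).

Variables (M : nat) (t : nat -> R) (r : nat -> nat) (Xs : nat -> set X).
Hypothesis t_0 : t 0%N = 0.
Hypothesis t_incr : forall i, (i < M)%N -> t i < t i.+1.
Hypothesis Xs_findim : forall i, (i <= M)%N -> findim_subspace (Xs i).
Variables (f : R -> H) (u0 : H) (U : R -> X).
Hypothesis U_sol : dG_solution dotH iota A M t r Xs f u0 U.

Lemma node_le i j : (i <= j)%N -> (j <= M)%N -> t i <= t j.
Proof.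
elim: j => [|j IHj]; first by rewrite leqn0 => /eqP->.
rewrite leq_eqVlt => /orP[/eqP->//|ij] jM.
by apply: le_trans (IHj _ (ltnW jM)) (ltW (t_incr jM)).
Qed.

Lemma C_max_le_gamma m i : (i < m)%N ->
  C_max dotH iota A (Xs i.+1) (r i.+1) (t i) (t i.+1) <= dG_gamma dotH iota A t r Xs m.
Proof.
move=> im; rewrite /dG_gamma.
have i_in : i.+1 \in index_iota 1 m.+1 by rewrite mem_index_iota.
exact: (le_bigmax_seq 0 i.+1 predT
  (fun l => C_max dotH iota A (Xs l) (r l) (t l.-1) (t l)) i_in isT).
Qed.

Lemma gamma_ge0 m : 0 <= dG_gamma dotH iota A t r Xs m.
Proof. exact: bigmax_ge_id. Qed.

(** [E i] is the squared L2 norm of [f] on ]0, t_i[. The induction over the steps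
    carries the bound for the left limit at [t_i] together with the bound for all
    earlier times. *)
Lemma dG_bound m (E : nat -> R) : (m <= M)%N ->
  (forall i, (i <= m)%N -> (\int[mu]_(x in `]0%R, t i[) (`|f x| ^+ 2)%:E =
    (E i)%:E)%E) ->
  forall i, (i <= m)%N ->
  `|iota (left_value dotH iota t Xs u0 U i)| <=
    `|iota (orth_proj dotH iota (Xs 0%N) u0)|
     + dG_gamma dotH iota A t r Xs m * Num.sqrt (t i * E i) /\
  forall s, 0 < s <= t i -> `|iota (U s)| <=
    `|iota (orth_proj dotH iota (Xs 0%N) u0)|
     + dG_gamma dotH iota A t r Xs m * Num.sqrt (t i * E i).
Proof.
move=> mM EE; have gam_ge0 := gamma_ge0 m.
set gam := dG_gamma _ _ _ _ _ _ _ in gam_ge0 *.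
have E_ge0 i : (i <= m)%N -> 0 <= E i.
  move=> im; rewrite -lee_fin -(EE i im); apply: integral_ge0 => x _.
  by rewrite lee_fin sqr_ge0.
elim=> [_ /=|i IHi im].
  split; first by rewrite lerDl mulr_ge0// sqrtr_ge0.
  by move=> s; rewrite t_0 => /andP[s0 /(lt_le_trans s0)]; rewrite ltxx.
have [IHl IHs] := IHi (ltnW im); have iM := leq_trans im mM.
have ti_ge0 : 0 <= t i by rewrite -t_0 node_le// ltnW.
have ltt := t_incr iM.
have f2_ge0 x : (0 <= (`|f x| ^+ 2)%:E)%E by rewrite lee_fin sqr_ge0.
have sup : (\int[mu]_(x in `]0%R, t i[) (`|f x| ^+ 2)%:E +
    \int[mu]_(x in `]t i, t i.+1[) (`|f x| ^+ 2)%:E <=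
    \int[mu]_(x in `]0%R, t i.+1[) (`|f x| ^+ 2)%:E)%E.
  apply: integral_superadditive => //.
  - by apply: subset_itvl; rewrite bnd_simp ltW.
  - by apply: subset_itvr; rewrite bnd_simp.
  - apply/seteqP; split => // x [] /=; rewrite !in_itv /= => /andP[_ xt] /andP[tx _].
    by move: (lt_trans xt tx); rewrite ltxx.
have finN : (\int[mu]_(x in `]t i, t i.+1[) (`|f x| ^+ 2)%:E)%E \is a fin_num.
  rewrite ge0_fin_numE ?integral_ge0//.
  apply: le_lt_trans (_ : _ <= (E i.+1)%:E)%E (ltry _).
  rewrite -EE//; apply: le_integral_subset => //.
  by apply: subset_itvr; rewrite bnd_simp.
set N := fine (\int[mu]_(x in `]t i, t i.+1[) (`|f x| ^+ 2)%:E)%E.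
have N_ge0 : 0 <= N by rewrite fine_ge0// integral_ge0.
move: sup; rewrite -(fineK finN) !EE// ?(ltnW im)// -EFinD lee_fin -/N => EN.
have step := U_sol (i := i.+1) iM.
have k_gt0 : 0 < t i.+1 - t i by rewrite subr_gt0.
have sqrt_le : Num.sqrt (t i * E i) + Num.sqrt ((t i.+1 - t i) * N) <=
    Num.sqrt (t i.+1 * E i.+1).
  apply: le_trans (sqrt_mul_add ti_ge0 (ltW k_gt0) (E_ge0 i (ltnW im)) N_ge0) _.
  rewrite (addrC (t i)) subrK; apply: ler_wsqrtr; apply: ler_wpM2l => //.
  exact: le_trans ti_ge0 (ltW ltt).
have Us s : t i < s <= t i.+1 -> `|iota (U s)| <=
    `|iota (orth_proj dotH iota (Xs 0%N) u0)| + gam * Num.sqrt (t i.+1 * E i.+1).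
  move=> sit; apply: le_trans (dG_step_bound dotH_norm iota_inj A_lin A_sym A_pos
    (Xs_findim iM) ltt step (N := N) _ gam_ge0 _ sit) _.
  - by rewrite fineK.
  - exact: C_max_le_gamma.
  apply: le_trans (lerD IHl (lexx _)) _.
  by rewrite -addrA -mulrDr lerD2l; apply: ler_wpM2l.
split.
  have [[c [_ Uc]] _] := step.
  have UE x : t i < x <= t i.+1 -> U x = vpoly (fun k : 'I_(r i.+1).+1 => 'X^k) c x.
    by move=> xab; rewrite Uc /= ?in_itv//; apply: eq_bigr => k _; rewrite hornerXn.
  rewrite /left_value (lim_vpoly_left ltt UE) -UE ?Us// ltt lexx//.
move=> s /andP[s0 st]; have [sti|tis] := leP s (t i); last by apply: Us; rewrite tis.
apply: le_trans (IHs s _) _; first by rewrite s0.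
rewrite lerD2l ler_wpM2l//; apply: le_trans sqrt_le.
by rewrite lerDl sqrtr_ge0.
Qed.

End Stability.

Unset Implicit Arguments.

Theorem theorem4p12 (R : realType) (H X : completeNormedModType R)
  (dotH : {dot H for idfun}) (dotX : {dot X for idfun})
  (dotH_norm : induces_norm dotH) (dotX_norm : induces_norm dotX)
  (iota : {linear X -> H}) (iota_inj : injective iota)
  (iota_cont : continuous iota) (iota_dense : dense (range iota))
  (A : {linear X -> (X -> R^o)}) (A_dual : forall v, dual (A v))
  (A_sym : forall v w, A v w = A w v)
  (alpha : R) (alpha_gt0 : 0 < alpha)
  (A_coercive : forall v : X, alpha * `|v| ^+ 2 <= A v v)
  (beta : R) (beta_gt0 : 0 < beta)
  (A_bounded : forall v w, `|A v w| <= beta * `|v| * `|w|)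
  (T : R) (T_gt0 : 0 < T)
  (f : R -> H) (f_L2 : in_L2 `]0, T[ f) (u0 : H)
  (M : nat) (t : nat -> R) (t_0 : t 0%N = 0) (t_M : t M = T)
  (t_incr : forall i, (i < M)%N -> t i < t i.+1)
  (r : nat -> nat)
  (Xs : nat -> set X) (Xs_findim : forall i, (i <= M)%N -> findim_subspace (Xs i))
  (U : R -> X) (U_sol : dG_solution dotH iota A M t r Xs f u0 U)
  (m : nat) (m_range : (1 <= m <= M)%N) :
  (Linf_norm (`]0, t m[%classic)%R (iota \o U) <=
     `|iota (orth_proj dotH iota (Xs 0%N) u0)|%:E
     + (dG_gamma dotH iota A t r Xs m * Num.sqrt (t m))%:E
       * L2_norm (`]0, t m[%classic)%R f)%E.
Proof.
have mM : (m <= M)%N by case/andP: m_range.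
have A_lin v : linear (A v) := (A_dual v).1.
have A_pos v : v != 0 -> 0 < A v v.
  move=> vN0; apply: lt_le_trans (A_coercive v).
  by rewrite mulr_gt0// exprn_gt0// normr_gt0.
have fin_L2 i : (i <= m)%N -> (L2_norm `]0%R, t i[ f < +oo)%E.
  move=> im; apply: (le_lt_trans _ f_L2.2); apply: L2_norm_subset.
  apply: subset_itvl; rewrite bnd_simp -t_M.
  by apply: (node_le t_incr) => //; exact: leq_trans im mM.
pose E i := fine (L2_norm `]0%R, t i[ f) ^+ 2.
have EE i : (i <= m)%N ->
    (\int[lebesgue_measure]_(x in `]0%R, t i[) (`|f x| ^+ 2)%:E = (E i)%:E)%E.
  by move=> im; have [L _ [LE ->]] := L2_normP (fin_L2 i im); rewrite /E LE.
have [_ Us] := dG_bound dotH_norm iota_inj A_lin A_sym A_pos t_0 t_incr Xs_findim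
  U_sol mM EE (leqnn m).
have tm_ge0 : 0 <= t m by rewrite -t_0 (node_le t_incr).
have [L L_ge0 [LE _]] := L2_normP (fin_L2 m (leqnn m)).
have ELE : Num.sqrt (t m * E m) = Num.sqrt (t m) * L.
  by rewrite sqrtrM// /E LE sqrtr_sqr ger0_norm.
rewrite LE -EFinM -EFinD; apply: Linf_norm_le.
  by rewrite addr_ge0 ?mulr_ge0 ?sqrtr_ge0 ?gamma_ge0.
move=> s; rewrite /= in_itv /= => /andP[s0 st].
by rewrite -mulrA -ELE Us// s0 ltW.
Qed.
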